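(* For every positive integer $k$, $$\int_{\mathbb{R}}\mathbb{E}_{Q\sim\mathrm{GOE}(k)}\left[\det(Q-u\mathbb{1})^2\right]e^{-u^2}\,du=\sqrt{\pi}\,\frac{(k+2)!}{2^{k+1}}.$$
   Context: $\mathrm{GOE}(k)$ is the probability measure on the space $\mathrm{Sym}(k,\mathbb{R})$ of real symmetric $k\times k$ matrices (dimension $K=\frac{k(k+1)}2$) with density $\frac{1}{\sqrt2^{\,k}\sqrt\pi^{\,K}}e^{-\mathrm{tr}(A^2)/2}$ with respect to the Lebesgue measure $dA=\prod_{1\le i\le j\le k}dA_{ij}$; equivalently the diagonal entries are $N(0,1)$, the entries above the diagonal are $N(0,\tfrac12)$, all independent. $\mathbb{1}$ is the identity matrix. *)

(* Defs.v *)
From Stdlib Require Import Reals Lra Arith.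
Open Scope R_scope.

Definition IntR (f : R -> R) (l : R) : Prop :=
  (forall a b : R, inhabited (Riemann_integrable f a b)) /\
  forall eps : R, 0 < eps -> exists M : R, forall a b : R,
    a <= - M -> M <= b -> forall pr : Riemann_integrable f a b,
      Rabs (RiemannInt pr - l) < eps.

Definition vcons (x : R) (v : nat -> R) : nat -> R :=
  fun n => match n with O => x | S m => v m end.

(* Iterated improper integral over R^n of F (only the first n
   coordinates of the argument matter); the first coordinate is outermost. *)
Fixpoint IntRn (n : nat) (F : (nat -> R) -> R) (l : R) : Prop :=
  match n with
  | O => l = F (fun _ => 0)
  | S m => exists g : R -> R,
      (forall x : R, IntRn m (fun v => F (vcons x v)) (g x)) /\ IntR g l
  end.

Fixpoint det (n : nat) (M : nat -> nat -> R) : R :=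
  match n with
  | O => 1
  | S m => sum_f_R0 (fun j => (-1) ^ j * M 0%nat j *
             det m (fun i j' => M (S i) (if (j' <? j)%nat then j' else S j'))) m
  end.

Definition trsq (n : nat) (M : nat -> nat -> R) : R :=
  sum_f_R0 (fun i => sum_f_R0 (fun j => M i j * M j i) (n - 1)) (n - 1).

Definition symdim (k : nat) : nat := (k * (k + 1) / 2)%nat.

(* coordinate index of the entry (i,j), i <= j < k, a bijection onto [0,K) *)
Definition symidx (i j : nat) : nat := (j * (j + 1) / 2 + i)%nat.

Definition symM (v : nat -> R) (i j : nat) : R :=
  if (i <=? j)%nat then v (symidx i j) else v (symidx j i).

(* GOE(k) density w.r.t. dA = prod_{i<=j} dA_ij *)
Definition goe_density (k : nat) (A : nat -> nat -> R) : R :=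
  exp (- trsq k A / 2) / (sqrt 2 ^ k * sqrt PI ^ symdim k).

Definition shift (Q : nat -> nat -> R) (u : R) (i j : nat) : R :=
  Q i j - (if Nat.eq_dec i j then u else 0).

(* Main.v *)
(** For [Q] in GOE(k), consider the polynomial
    [H_k(x, w) = E det ((x - Q)^2 - w)], whose value at [w = 0] is [E det (Q - x)^2].
    Expanding along the last row and column and averaging over it gives
    [H_(k+1) = T H_k] for an explicit second order differential operator [T]: this
    uses that [tr adj (x - Q)] is the derivative of the characteristic polynomial
    and the resolvent identity for the product of two adjugates at [x + y] and
    [x - y], where [w = y^2].  Writing [w = - |z|^2] with [z] in R^5, the operator
    [T] is the sum of the squares of the six commuting operators [x - dx/4],
    [z_i + dz_i/4], so [T^k 1] is an eigenvector, of eigenvalue [2k], of the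
    corresponding Euler operator [N].  Integration by parts against [e^(-x^2)] at
    [w = 0] turns [T] into [(6 + N) / 4], so that every step multiplies the integral
    by [(k + 3) / 2]. *)

Require Import Defs.
From Stdlib Require Import Reals.

(** Write [p] for the characteristic polynomial of [Q]. A recursion for [E p(x)^2] alone does not
    close: in the normalization of [16 T], averaging over the border leaves [12 p'^2 - 8 p p''],
    whereas the derivatives of [p^2] contain these two terms only as [p'^2 + p p'']. In the product
    [p(x + y) p(x - y)] the derivatives in [x] and in [y] tell them apart. This product is even in
    [y], and in terms of [w = y^2] the divided difference supplied by the resolvent identity is just
    [- dw]. The dimension 5 is read off the coefficient 10 of [dw] in [16 T]: the Laplacian in R^d
    of [f(- |z|^2)] contributes [- 2 d f'], and 10 = 8 + 2, with 8 from the trace of the product of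
    adjugates and 2 from the second derivative in [y]. The constant 1 in [T] is then exactly the
    ordering term [(5 - 1) / 4] of the six squares. *)

Module BivariateOperators.
From HB Require Import structures.
From mathcomp Require Import all_boot all_order all_algebra.
From mathcomp Require Import ring zify.
Set Implicit Arguments. Unset Strict Implicit. Unset Printing Implicit Defensive.
Import GRing.Theory Num.Theory.
Local Open Scope ring_scope.

(** * The bordering operator and its Euler operator, over two commuting derivations *)

Section CommutingDerivations.
Variables (A : comNzRingType) (dx dw : {additive A -> A}) (x w : A).
Hypothesis dxM : forall f g, dx (f * g) = dx f * g + f * dx g.
Hypothesis dwM : forall f g, dw (f * g) = dw f * g + f * dw g.
Hypotheses (dxx : dx x = 1) (dxw : dx w = 0) (dwx : dw x = 0) (dww : dw w = 1).
Hypothesis dwdx : forall f, dw (dx f) = dx (dw f).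

(* [16 T], where [T] is the effect on the averaged polynomial of bordering the
   matrix by one Gaussian row and column; with [w = - |z|^2], [z] in R^5, [T] is
   the squared length of the six commuting operators [x - dx / 4], [z + dz / 4]. *)
Definition goe_op f : A :=
  (1 + x * x - w) * f *+ 16 - x * dx f *+ 8 + w * dw f *+ 16
  + dx (dx f) - w * dw (dw f) *+ 4 - dw f *+ 10.

(* [4 N], where [N] is the Euler (degree) operator of those six operators. *)
Definition euler_op f : A :=
  x * dx f *+ 4 + w * dw f *+ 8 - dx (dx f) - w * dw (dw f) *+ 4 - dw f *+ 10.

(** With [X = x - dx / 4] and [Z_i = z_i + dz_i / 4], [N] is [X dx] plus the sum of the [Z_i dz_i],
    and [[dx, X] = [dz_i, Z_i] = 1]. Hence [T], a sum of squares of these operators, has degree 2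
    for [N], and the scalings 4 and 16 give [[4 N, 16 T] = 8 (16 T)]. Once the derivations are
    pushed inwards, the derivatives of [f] are atoms for [ring]. *)
Lemma euler_goe_op f : euler_op (goe_op f) = goe_op (euler_op f) + goe_op f *+ 8.
Proof.
have dx1 : dx 1 = 0 by apply: (addIr (dx 1)); rewrite add0r -[in RHS](mulr1 1) dxM mulr1 mul1r.
have dw1 : dw 1 = 0 by apply: (addIr (dw 1)); rewrite add0r -[in RHS](mulr1 1) dwM mulr1 mul1r.
have dxN g : dx (- g) = - dx g by exact: raddfN.
have dwN g : dw (- g) = - dw g by exact: raddfN.
have dxD g h : dx (g + h) = dx g + dx h by exact: raddfD.
have dwD g h : dw (g + h) = dw g + dw h by exact: raddfD.
have dxn g n : dx (g *+ n) = dx g *+ n by exact: raddfMn.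
have dwn g n : dw (g *+ n) = dw g *+ n by exact: raddfMn.
have dx0 : dx 0 = 0 by exact: raddf0.
have dw0 : dw 0 = 0 by exact: raddf0.
rewrite /euler_op /goe_op.
rewrite !(dxn, dwn, dxN, dwN, dxD, dwD, dxM, dwM, dxx, dxw, dwx, dww, dx1, dw1, dx0, dw0, dwdx).
ring.
Qed.
End CommutingDerivations.

(** * The operators on K[x][w] and the Gaussian moments of their iterates *)

Section BivariatePolynomials.
Variable K : numFieldType.
Implicit Types (F G : {poly {poly K}}) (p : {poly K}) (c : K).

Definition dx F : {poly {poly K}} := map_poly deriv F.

Lemma dx_is_additive : additive dx.
Proof. by move=> F G; apply/polyP=> i; rewrite !(coef_map, coefB) /= derivB. Qed.
HB.instance Definition _ :=
  GRing.isAdditive.Build {poly {poly K}} {poly {poly K}} dx dx_is_additive.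

Lemma dxM F G : dx (F * G) = dx F * G + F * dx G.
Proof.
apply/polyP=> i; rewrite coef_map coefD !coefM /= raddf_sum /= -big_split /=.
by apply: eq_bigr => j _; rewrite derivM !coef_map.
Qed.

Lemma dxC p : dx p%:P = p^`()%:P.
Proof. exact: map_polyC. Qed.

Lemma dxX : dx 'X = 0.
Proof.
apply/polyP=> i; rewrite coef_map coefX coef0 /=.
by case: eqP => _; rewrite ?raddf0 // -polyC1 derivC.
Qed.

Lemma deriv_dx F : (dx F)^`() = dx F^`().
Proof. by apply/polyP=> i; rewrite !(coef_map, coef_deriv) /= derivMn. Qed.

Local Notation x := (('X : {poly K})%:P).
Local Notation w := ('X : {poly {poly K}}).

Definition goe_step F : {poly {poly K}} := goe_op dx deriv x w F.

Definition goe_euler F : {poly {poly K}} := euler_op dx deriv x w F.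

Lemma goe_eulerE F : goe_euler (goe_step F) = goe_step (goe_euler F) + goe_step F *+ 8.
Proof.
apply: euler_goe_op.
- exact: dxM.
- exact: derivM.
- by rewrite /= dxC derivX.
- exact: dxX.
- exact: derivC.
- exact: derivX.
- exact: deriv_dx.
Qed.

Definition klinear (L : {poly {poly K}} -> K) : Prop :=
  (forall F G, L (F + G) = L F + L G) /\ (forall c F, L (c%:P%:P * F) = c * L F).

Lemma goe_stepD F G : goe_step (F + G) = goe_step F + goe_step G.
Proof.
by rewrite /goe_step /goe_op !(raddfD dx) !(raddfD (@deriv _)) /=; ring.
Qed.

Lemma goe_stepZ c F : goe_step (c%:P%:P * F) = c%:P%:P * goe_step F.
Proof.
have dZ G : dx (c%:P%:P * G) = c%:P%:P * dx G.
  by rewrite dxM dxC derivC mul0r add0r.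
have wZ G : (c%:P%:P * G)^`() = c%:P%:P * G^`().
  by rewrite derivM derivC mul0r add0r.
by rewrite /goe_step /goe_op /= !(dZ, wZ); ring.
Qed.

Lemma goe_euler_iter n :
  goe_euler (iter n goe_step 1) = iter n goe_step 1 *+ (8 * n).
Proof.
have e0 : goe_euler 1 = 0.
  have d1 : dx 1 = 0 by rewrite -polyC1 dxC -polyC1 derivC.
  have w1 : (1 : {poly {poly K}})^`() = 0 by rewrite -polyC1 derivC.
  rewrite /goe_euler /euler_op /= d1 w1 !raddf0; ring.
elim: n => [|n IHn]; first by rewrite muln0 mulr0n.
have stepMn m F : goe_step (F *+ m) = goe_step F *+ m.
  elim: m => [|m IHm]; last by rewrite !mulrS goe_stepD IHm.
  by rewrite !mulr0n /goe_step /goe_op /= !raddf0; ring.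
by rewrite iterS goe_eulerE IHn stepMn -mulrnDr mulnS addnC.
Qed.

Section Moments.
Variable m : nat -> K.

Definition moment_fun p : K := \sum_(i < size p) p`_i * m i.

Lemma moment_funE N p : (size p <= N)%N -> moment_fun p = \sum_(i < N) p`_i * m i.
Proof.
move=> sN; rewrite /moment_fun (big_ord_widen _ (fun i => p`_i * m i) sN).
rewrite big_mkcond; apply: eq_bigr => i _; case: ltnP => // pi.
by rewrite nth_default // mul0r.
Qed.

Lemma moment_funD p q : moment_fun (p + q) = moment_fun p + moment_fun q.
Proof.
rewrite !(@moment_funE (maxn (size p) (size q))) ?leq_maxl ?leq_maxr ?size_polyD //.
by rewrite -big_split; apply: eq_bigr => i _; rewrite coefD mulrDl.
Qed.

Lemma moment_funZ c p : moment_fun (c%:P * p) = c * moment_fun p.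
Proof.
rewrite !(@moment_funE (size p)) //; last by rewrite mul_polyC size_scale_leq.
by rewrite mulr_sumr; apply: eq_bigr => i _; rewrite coefCM mulrA.
Qed.

Lemma moment_fun0 : moment_fun 0 = 0.
Proof. by rewrite /moment_fun size_poly0 big_ord0. Qed.

Lemma moment_funMn p n : moment_fun (p *+ n) = moment_fun p *+ n.
Proof.
elim: n => [|n IHn]; first by rewrite !mulr0n moment_fun0.
by rewrite !mulrS moment_funD IHn.
Qed.

Hypotheses (m0 : m 0%N = 1) (m1 : m 1%N = 0).
Hypothesis mS : forall n, m n.+2 = 2^-1 * n.+1%:R * m n.

(* Gaussian integration by parts for the weight [exp (- x^2)]. *)
Lemma moment_fun_stein p : moment_fun p^`() = 2 * moment_fun ('X * p).
Proof.
set N := (size p).+1.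
rewrite (@moment_funE N); last by apply: leq_trans (size_poly _ _) _; rewrite /N; lia.
rewrite (@moment_funE N.+1); last first.
  by rewrite mulrC (leq_trans (size_polyMleq _ _)) // size_polyX addn2.
rewrite [in RHS]big_ord_recl coefXM /= mul0r add0r.
rewrite [in RHS]big_ord_recl coefXM /= m1 mulr0 add0r.
rewrite big_ord_recr /= coef_deriv nth_default ?mul0rn ?mul0r ?addr0; last exact: leqnSn.
rewrite mulr_sumr; apply: eq_bigr => i _.
rewrite coef_deriv coefXM /= /bump /= !add1n mS mulrnAl -mulr_natr; field.
by rewrite ?pnatr_eq0.
Qed.

(** At [w = 0] the [dw] terms of both sides agree, and [16 T - 24 - 4 N] sends the constant
    coefficient [f] of [F] to [(d/dx - 2 x) (2 f' - 8 x f)], which is a total derivative against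
    [exp (- x^2)]. *)
Lemma moment_fun_goe_step F :
  moment_fun (goe_step F)`_0 = moment_fun (F *+ 24 + goe_euler F)`_0.
Proof.
have E : (goe_step F)`_0 = ((1 + 'X * 'X) * F`_0) *+ 16 - ('X * (F`_0)^`()) *+ 8
    + (F`_0)^`()^`() - F`_1 *+ 10.
  rewrite /goe_step /goe_op coefB coefB coefD coefD coefB !coefMn !coefXM /=.
  rewrite mulrBl coefB coefXM /= mulrDl mul1r -polyCM coefD !coefCM !coef_map /=
    coef_deriv.
  by ring.
have E' : (F *+ 24 + goe_euler F)`_0 =
    F`_0 *+ 24 + ('X * (F`_0)^`()) *+ 4 - (F`_0)^`()^`() - F`_1 *+ 10.
  rewrite /goe_euler /euler_op coefD coefMn coefB coefB coefB coefD !coefMn !coefXM /=.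
  rewrite coefCM !coef_map /= coef_deriv.
  by ring.
rewrite E E'; move: (F`_0) (F`_1) => f g {E E'}.
have GN p : moment_fun (- p) = - moment_fun p.
  by apply/eqP; rewrite -addr_eq0 -moment_funD addNr moment_fun0.
have S1 := moment_fun_stein ('X * f).
have S2 := moment_fun_stein f^`().
rewrite derivM derivX mul1r moment_funD mulrA in S1.
rewrite mulrDl mul1r !(moment_funD, moment_funMn, GN).
have -> : moment_fun f = 2 * moment_fun ('X * 'X * f) - moment_fun ('X * f^`()).
  by rewrite -S1 addrK.
by rewrite S2; ring.
Qed.

(** The Euler eigenvalue [8 n] makes each step a multiplication by [24 + 8 n = 8 (n + 3)], starting
    from [1 = 2! / 2]. *)
Lemma moment_fun_iter_goe_step n :
  moment_fun (iter n goe_step 1)`_0 = 8 ^+ n * (n + 2)`!%:R / 2.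
Proof.
elim: n => [|n IHn].
  rewrite expr0 mul1r mulfV ?pnatr_eq0 // coef1 /moment_fun size_poly1.
  by rewrite big_ord1 coef1 m0 mulr1.
rewrite iterS moment_fun_goe_step goe_euler_iter -mulrnDr.
have -> : (n.+1 + 2)`! = ((n + 3) * (n + 2)`!)%N by rewrite addSnnS addnS factS.
rewrite coefMn moment_funMn IHn exprS -(mulr_natr _ (24 + 8 * n)) !natrD !natrM !natrD.
by ring.
Qed.

End Moments.
End BivariatePolynomials.

(** * Bordered determinants and the derivative of the characteristic polynomial *)

Lemma det_bordered (R : idomainType) n (M : 'M[R]_n) (b : 'cV[R]_n) (c : 'rV[R]_n)
    (a : R) : \det M != 0 ->
  \det (block_mx M b c a%:M) = a * \det M - (c *m \adj M *m b) 0 0.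
Proof.
move=> D0; set D := \det M.
(* A Schur complement cleared of denominators: eliminating with [\adj M] instead of the inverse
   multiplies the determinant by [\det (\adj M) * D = D ^+ n], which is cancelled because [D] is
   nonzero. *)
pose S := block_mx (\adj M) (- (\adj M *m b)) 0 (D%:M : 'M_1).
have E : block_mx M b c a%:M *m S =
    block_mx D%:M 0 (c *m \adj M) (a * D - (c *m \adj M *m b) 0 0)%:M.
  rewrite /S mulmx_block !mulmx0 !addr0 mul_mx_adj; congr block_mx.
    by rewrite mulmxN mulmxA mul_mx_adj mul_scalar_mx mul_mx_scalar addNr.
  rewrite mulmxN mulmxA -scalar_mxM raddfB /= addrC; congr (_ - _).
  exact: mx11_scalar.
have detA : \det (\adj M) * D = D ^+ n.
  by rewrite -det_mulmx mul_adj_mx det_scalar.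
have := congr1 determinant E.
rewrite det_mulmx det_ublock det_lblock !det_scalar expr1 detA mulrC.
by move/(mulfI (expf_neq0 n D0)); rewrite expr1.
Qed.

Lemma deriv_prod (R : comNzRingType) n (f : 'I_n -> {poly R}) :
  (\prod_i f i)^`() = \sum_i \prod_j (if j == i then (f j)^`() else f j).
Proof.
elim: n f => [|n IHn] f; first by rewrite !big_ord0 -polyC1 derivC.
rewrite big_ord_recl derivM IHn [in RHS]big_ord_recl big_ord_recl eqxx.
congr (_ * _ + _); rewrite mulr_sumr; apply: eq_bigr => i _.
rewrite big_ord_recl /=; congr (_ * _); apply: eq_bigr => j _.
Qed.

Lemma deriv_det (R : comNzRingType) n (M : 'M[{poly R}]_n) :
  (\det M)^`() = \sum_i \sum_j (M i j)^`() * cofactor M i j.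
Proof.
(* Leibniz row by row: [M' i] has row [i] differentiated, and expanding along that row meets only
   cofactors of [M] itself. *)
pose M' i := \matrix_(k, l) (if k == i then (M k l)^`() else M k l).
have -> : (\det M)^`() = \sum_i \det (M' i).
  rewrite /determinant raddf_sum /= exchange_big /=; apply: eq_bigr => s _.
  rewrite -mulr_sumr -signr_odd mulr_sign; case: ifP => _.
    rewrite derivN deriv_prod mulr_sign.
    congr (- _); apply: eq_bigr => i _; apply: eq_bigr => j _.
    by rewrite mxE.
  rewrite deriv_prod mulr_sign.
  by apply: eq_bigr => i _; apply: eq_bigr => j _; rewrite mxE.
apply: eq_bigr => i _; rewrite (expand_det_row _ i); apply: eq_bigr => j _.
rewrite mxE eqxx; congr (_ * (_ * \det _)); apply/matrixP => k l.
by rewrite !mxE eq_sym (negbTE (neq_lift i k)).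
Qed.

Lemma deriv_char_poly (R : comNzRingType) n (Q : 'M[R]_n) :
  (char_poly Q)^`() = \tr (\adj (char_poly_mx Q)).
Proof.
rewrite deriv_det; apply: eq_bigr => i _; rewrite (bigD1 i) //= big1 => [|j ji].
  by rewrite addr0 !mxE eqxx derivB derivX derivC subr0 mul1r.
by rewrite !mxE eq_sym (negbTE ji) sub0r derivN derivC oppr0 mul0r.
Qed.

Lemma char_poly_bordered (K : fieldType) n (Q : 'M[K]_n) (b : 'cV[K]_n) (a : K) :
  char_poly (block_mx Q b b^T a%:M) = ('X - a%:P) * char_poly Q
    - \sum_i \sum_j (b i 0 * b j 0)%:P * \adj (char_poly_mx Q) i j.
Proof.
rewrite /char_poly /char_poly_mx map_block_mx scalar_mx_block opp_block_mx add_block_mx.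
rewrite map_scalar_mx -raddfB /= !add0r det_bordered; last first.
  exact: (monic_neq0 (char_poly_monic Q)).
congr (_ - _); rewrite !mxE exchange_big; apply: eq_bigr => i _.
rewrite !mxE mulr_suml; apply: eq_bigr => j _; rewrite !mxE.
by rewrite mulNr mulrN mulNr opprK polyCM; ring.
Qed.

(** * The two-point product p(x + y) p(x - y) and the resolvent identity *)

Section SquaredCharPoly.
Variable K : numFieldType.
Implicit Types (F G z : {poly {poly K}}) (p : {poly K}) (c : K).

Definition polyev z p : {poly {poly K}} := map_poly polyC p \Po z.

Lemma polyev_is_additive z : additive (polyev z).
Proof. by move=> p q; rewrite /polyev !raddfB. Qed.
Lemma polyev_is_multiplicative z : multiplicative (polyev z).
Proof. by split=> [p q|]; rewrite /polyev ?rmorphM ?rmorph1. Qed.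
HB.instance Definition _ z :=
  GRing.isAdditive.Build {poly K} {poly {poly K}} (polyev z) (polyev_is_additive z).
HB.instance Definition _ z :=
  GRing.isMultiplicative.Build {poly K} {poly {poly K}} (polyev z) (polyev_is_multiplicative z).

Lemma polyevC z c : polyev z c%:P = c%:P%:P.
Proof. by rewrite /polyev map_polyC comp_polyC. Qed.

Lemma polyevX z : polyev z 'X = z.
Proof. by rewrite /polyev map_polyX comp_polyX. Qed.

(** Chain rule for an abstract derivation, so that it serves both [dx] and the derivative in [y]. *)
Lemma derivation_polyev (d : {poly {poly K}} -> {poly {poly K}}) z p :
  (forall F G, d (F + G) = d F + d G) ->
  (forall F G, d (F * G) = d F * G + F * d G) -> (forall c, d c%:P%:P = 0) ->
  d (polyev z p) = polyev z p^`() * d z.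
Proof.
move=> dD dM dC; elim/poly_ind: p => [|p c IHp].
  by have := dC 0; rewrite derivC !raddf0 mul0r.
rewrite derivMXaddC !(rmorphD (polyev z)) !(rmorphM (polyev z)) /= polyevC polyevX.
by rewrite dD dM dC IHp; ring.
Qed.

Local Notation x := (('X : {poly K})%:P).
Local Notation y := ('X : {poly {poly K}}).

Definition charpoly2 n (Q : 'M[K]_n) : {poly {poly K}} :=
  polyev (x + y) (char_poly Q) * polyev (x - y) (char_poly Q).

(* [det ((x - Q)^2 - w)], obtained from [charpoly2] by substituting [w] for [y^2]. *)
Definition sqcharpoly n (Q : 'M[K]_n) : {poly {poly K}} := even_poly (charpoly2 Q).

Lemma polyev_compNX z p : polyev z p \Po (- y) = polyev (z \Po (- y)) p.
Proof. by rewrite /polyev comp_polyA. Qed.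

(** The substitution of [- y] for [y] swaps the two factors of [charpoly2 Q], so its odd part equals
    its own opposite and vanishes in characteristic zero. *)
Lemma sqcharpolyE n (Q : 'M[K]_n) : sqcharpoly Q \Po 'X^2 = charpoly2 Q.
Proof.
rewrite /sqcharpoly; set P := charpoly2 Q.
have PN : P \Po (- y) = P.
  rewrite /P /charpoly2 rmorphM /= !polyev_compNX mulrC.
  by rewrite !(raddfD, raddfN) /= comp_polyX comp_polyC opprK.
have sq : ('X^2 : {poly {poly K}}) \Po (- y) = 'X^2 by rewrite comp_Xn_poly sqrrN.
have := PN; rewrite -{1 2}[P]poly_even_odd raddfD /= rmorphM /= -!comp_polyA sq comp_polyX.
set o := odd_poly P \Po _ => /addrI h.
have /eqP : (o * y) *+ 2 = 0 by rewrite mulr2n -{1}h mulrN addNr.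
rewrite -mulr_natr mulf_eq0 mulf_eq0 polyX_eq0 orbF -!polyC_natr !polyC_eq0 pnatr_eq0 orbF.
by move=> /eqP od; rewrite -[RHS]poly_even_odd -/o od mul0r addr0.
Qed.

Lemma dx_compXn F : dx (F \Po 'X^2) = dx F \Po 'X^2.
Proof.
apply/polyP=> i; rewrite coef_map !coef_comp_poly_Xn //= coef_map.
by case: ifP => // _; rewrite raddf0.
Qed.

(** Resolvent identity: the characteristic matrices at [zp] and [zm] differ by the scalar [zp - zm];
    multiply this difference by [A zp] on the left and [A zm] on the right, then take traces. *)
Lemma tr_adj_mul n (Q : 'M[K]_n) (zp zm : {poly {poly K}}) :
  let A z := map_mx (polyev z) (\adj (char_poly_mx Q)) in
  (zp - zm) * \tr (A zp *m A zm) =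
  polyev zp (char_poly Q) * polyev zm (char_poly Q)^`()
  - polyev zm (char_poly Q) * polyev zp (char_poly Q)^`().
Proof.
move=> A; pose M z := map_mx (polyev z) (char_poly_mx Q).
have trA z : \tr (A z) = polyev z (char_poly Q)^`().
  by rewrite deriv_char_poly /A trace_map_mx.
have MA z : M z *m A z = (polyev z (char_poly Q))%:M.
  by rewrite -map_mxM mul_mx_adj map_scalar_mx.
have AM z : A z *m M z = (polyev z (char_poly Q))%:M.
  by rewrite -map_mxM mul_adj_mx map_scalar_mx.
have MB : M zp - M zm = (zp - zm)%:M.
  apply/matrixP => i j; rewrite !mxE !(rmorphB (polyev _)) /= !polyevC.
  by rewrite !(rmorphMn (polyev _)) /= !polyevX mulrnBl; ring.
rewrite -!trA -!mxtraceZ -raddfB /=; congr (\tr _).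
by rewrite scalemxAl -mul_mx_scalar -MB mulmxBr mulmxBl AM -mulmxA MA
  mul_scalar_mx mul_mx_scalar.
Qed.

(** The right-hand side is the shape in which the average over the border comes out; [goe_op] is
    made to match it. Since [H(x, y^2) = s(x + y) s(x - y)], the resolvent identity gives [- dw H]
    for the trace of the product of adjugates, and comparing second derivatives in [x] and [y] gives
    [dx^2 H - 4 w dw^2 H - 2 dw H = 4 s'(x + y) s'(x - y)] for the product of traces. *)
Lemma goe_step_sqcharpoly n (Q : 'M[K]_n) :
  let A z := map_mx (polyev z) (\adj (char_poly_mx Q)) in
  let s z := polyev z (char_poly Q) in
  goe_step (sqcharpoly Q) \Po 'X^2 =
  ((1 + (x + y) * (x - y)) * s (x + y) * s (x - y)) *+ 16
  - ((x + y) * s (x + y) * \tr (A (x - y))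
     + (x - y) * s (x - y) * \tr (A (x + y))) *+ 8
  + (\tr (A (x + y)) * \tr (A (x - y))) *+ 4
  + \tr (A (x + y) *m A (x - y)) *+ 8.
Proof.
move=> A s; set H := sqcharpoly Q.
pose s' z := polyev z (char_poly Q)^`().
have trA z : \tr (A z) = s' z by rewrite /s' deriv_char_poly /A trace_map_mx.
rewrite !trA.
have HK : H \Po 'X^2 = s (x + y) * s (x - y) by exact: sqcharpolyE.
have dwM F G : (F * G)^`() = F^`() * G + F * G^`() by exact: derivM.
have dwD F G : (F + G)^`() = F^`() + G^`() by exact: derivD.
have dxD F G : dx (F + G) = dx F + dx G by exact: raddfD.
have dwC c : (c%:P%:P : {poly {poly K}})^`() = 0 by exact: derivC.
have dxCC c : dx (c%:P%:P : {poly {poly K}}) = 0 by rewrite dxC derivC.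
have dyp p : (polyev (x + y) p)^`() = polyev (x + y) p^`().
  by rewrite (derivation_polyev _ _ dwD dwM dwC) /= derivD derivC derivX add0r mulr1.
have dym p : (polyev (x - y) p)^`() = - polyev (x - y) p^`().
  by rewrite (derivation_polyev _ _ dwD dwM dwC) /= derivB derivC derivX sub0r mulrN1.
have dxp p : dx (polyev (x + y) p) = polyev (x + y) p^`().
  by rewrite (derivation_polyev _ _ dxD (@dxM K) dxCC) /= raddfD /= dxC dxX derivX addr0 mulr1.
have dxm p : dx (polyev (x - y) p) = polyev (x - y) p^`().
  by rewrite (derivation_polyev _ _ dxD (@dxM K) dxCC) /= raddfB /= dxC dxX derivX subr0 mulr1.
have E1 : dx H \Po 'X^2 = s' (x + y) * s (x - y) + s (x + y) * s' (x - y).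
  by rewrite -dx_compXn HK dxM dxp dxm.
have E2 : dx (dx H) \Po 'X^2 = polyev (x + y) (char_poly Q)^`()^`() * s (x - y)
    + s' (x + y) * s' (x - y) *+ 2 + s (x + y) * polyev (x - y) (char_poly Q)^`()^`().
  by rewrite -dx_compXn E1 raddfD /= !dxM !dxp !dxm; ring.
have dX2 : ('X^2 : {poly {poly K}})^`() = y *+ 2 by rewrite derivXn expr1.
have E3 : (H^`() \Po 'X^2) * y *+ 2 = s' (x + y) * s (x - y) - s (x + y) * s' (x - y).
  by rewrite -mulrnAr -dX2 -deriv_comp HK derivM dyp dym mulrN.
have E4 : (H^`()^`() \Po 'X^2) * y * y *+ 4 + (H^`() \Po 'X^2) *+ 2 =
    polyev (x + y) (char_poly Q)^`()^`() * s (x - y)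
    - s' (x + y) * s' (x - y) *+ 2 + s (x + y) * polyev (x - y) (char_poly Q)^`()^`().
  have := congr1 (@deriv _) E3; rewrite derivMn derivM deriv_comp dX2 derivX.
  rewrite derivB !derivM !dyp !dym => e.
  transitivity (((H^`()^`() \Po 'X^2) * (y *+ 2) * y + (H^`() \Po 'X^2) * 1) *+ 2).
    by ring.
  by rewrite e; ring.
have y0 : y *+ 2 != 0.
  by rewrite -mulr_natr mulf_neq0 ?polyX_eq0 // -!polyC_natr !polyC_eq0 pnatr_eq0.
have E5 : \tr (A (x + y) *m A (x - y)) = - (H^`() \Po 'X^2).
  apply: (mulfI y0).
  have -> : y *+ 2 * - (H^`() \Po 'X^2) = - ((H^`() \Po 'X^2) * y *+ 2) by ring.
  have -> : y *+ 2 = x + y - (x - y) by ring.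
  by rewrite E3 tr_adj_mul /s /s'; ring.
have cM F G : (F * G) \Po 'X^2 = (F \Po 'X^2) * (G \Po 'X^2) by exact: rmorphM.
have cD F G : (F + G) \Po 'X^2 = (F \Po 'X^2) + (G \Po 'X^2) by exact: rmorphD.
have cN F : (- F) \Po 'X^2 = - (F \Po 'X^2) by exact: rmorphN.
have cn F k : (F *+ k) \Po 'X^2 = (F \Po 'X^2) *+ k by exact: rmorphMn.
have c1 : (1 : {poly {poly K}}) \Po 'X^2 = 1 by exact: rmorph1.
rewrite E5 /goe_step /goe_op /= !(cn, cM, cD, cN) c1 comp_polyC comp_polyX HK E1 E2.
move: E3 E4; set h := H^`() \Po _; set k := H^`()^`() \Po _ => E3 E4.
have -> : 'X^2 * k *+ 4 = k * y * y *+ 4 + h *+ 2 - h *+ 2 by ring.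
have -> : 'X^2 * h *+ 16 = y * (h * y *+ 2) *+ 8 by ring.
by rewrite E3 E4; ring.
Qed.

End SquaredCharPoly.

Lemma rmorph_char_poly_bordered (K : numFieldType)
    (f : {rmorphism {poly K} -> {poly {poly K}}}) n (Q : 'M[K]_n) (b : 'cV[K]_n) (a : K) :
  f (char_poly (block_mx Q b b^T a%:M)) = (f 'X - f a%:P) * f (char_poly Q)
    - \sum_i \sum_j f (b i 0 * b j 0)%:P * f (\adj (char_poly_mx Q) i j).
Proof.
rewrite char_poly_bordered rmorphB rmorphM rmorphB; congr (_ - _).
rewrite rmorph_sum; apply: eq_bigr => i _; rewrite rmorph_sum; apply: eq_bigr => j _.
by rewrite rmorphM.
Qed.

(** * Expanding the bordered polynomial and averaging over the border *)

Section ColumnExpectation.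
Variable K : numFieldType.

Definition col_mono (s : seq nat) (v : nat -> K) : {poly {poly K}} :=
  (\prod_(i <- s) v i)%:P%:P.

Definition bordered n (Q : 'M[K]_n) (v : nat -> K) : 'M[K]_(n + 1) :=
  block_mx Q (\col_i v i) (\col_(i < n) v i)^T (v n)%:M.

Variables (n : nat) (Q : 'M[K]_n).
Hypothesis Qsym : Q^T = Q.

Local Notation x := (('X : {poly K})%:P).
Local Notation y := ('X : {poly {poly K}}).
Local Notation sp := (polyev (x + y) (char_poly Q)).
Local Notation sm := (polyev (x - y) (char_poly Q)).
Local Notation Ap := (map_mx (polyev (x + y)) (\adj (char_poly_mx Q))).
Local Notation Am := (map_mx (polyev (x - y)) (\adj (char_poly_mx Q))).

(* [charpoly2] of the bordered matrix, with [e s] in place of the monomial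
   [prod_(i <- s) v i] in the entries of the border. *)
Definition border_sum (e : seq nat -> {poly {poly K}}) : {poly {poly K}} :=
  (x + y) * (x - y) * sp * sm * e [::] + - (x *+ 2 * sp * sm) * e [:: n]
  + sp * sm * e [:: n; n]
  + \sum_(i < n) \sum_(j < n)
      (- ((x + y) * sp * Am i j + (x - y) * sm * Ap i j)) * e [:: i : nat; j : nat]
  + \sum_(i < n) \sum_(j < n) (sp * Am i j + sm * Ap i j) * e [:: n; i : nat; j : nat]
  + \sum_(i < n) \sum_(j < n) \sum_(k < n) \sum_(l < n)
      Ap i j * Am k l * e [:: i : nat; j : nat; k : nat; l : nat].

Lemma charpoly2_bordered v : charpoly2 (bordered Q v) = border_sum (fun s => col_mono s v).
Proof.
have E z : polyev z (char_poly (bordered Q v)) =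
    (z - (v n)%:P%:P) * polyev z (char_poly Q)
    - \sum_(i < n) \sum_(j < n)
        col_mono [:: i : nat; j : nat] v * map_mx (polyev z) (\adj (char_poly_mx Q)) i j.
  apply: etrans (@rmorph_char_poly_bordered K (polyev z) n Q (\col_i v i) (v n)) _.
  rewrite /= polyevX polyevC; congr (_ - _).
  apply: eq_bigr => i _; apply: eq_bigr => j _.
  by rewrite polyevC !mxE /col_mono !big_cons big_nil mulr1.
rewrite /charpoly2 !E /border_sum.
set Bp := \sum_(i < n) \sum_(j < n) _ * Ap i j.
set Bm := \sum_(i < n) \sum_(j < n) _ * Am i j.
have -> : \sum_(i < n) \sum_(j < n) (- ((x + y) * sp * Am i j + (x - y) * sm * Ap i j)) *
    col_mono [:: i : nat; j : nat] v = - ((x + y) * sp * Bm + (x - y) * sm * Bp).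
  rewrite /Bm /Bp !mulr_sumr -big_split -sumrN; apply: eq_bigr => i _ /=.
  rewrite !mulr_sumr -big_split -sumrN; apply: eq_bigr => j _ /=; ring.
have -> : \sum_(i < n) \sum_(j < n) (sp * Am i j + sm * Ap i j) *
    col_mono [:: n; i : nat; j : nat] v = (v n)%:P%:P * (sp * Bm + sm * Bp).
  rewrite /Bm /Bp !mulr_sumr -big_split mulr_sumr; apply: eq_bigr => i _ /=.
  rewrite !mulr_sumr -big_split mulr_sumr; apply: eq_bigr => j _ /=.
  rewrite /col_mono !big_cons !big_nil !polyCM; ring.
have -> : \sum_(i < n) \sum_(j < n) \sum_(k < n) \sum_(l < n)
      Ap i j * Am k l * col_mono [:: i : nat; j : nat; k : nat; l : nat] v = Bp * Bm.
  rewrite /Bp mulr_suml; apply: eq_bigr => i _.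
  rewrite mulr_suml; apply: eq_bigr => j _.
  rewrite /Bm mulr_sumr; apply: eq_bigr => k _.
  rewrite mulr_sumr; apply: eq_bigr => l _.
  rewrite /col_mono !big_cons !big_nil !polyCM; ring.
rewrite /col_mono !big_cons !big_nil !polyCM !polyC1; ring.
Qed.

(** Of the three Wick pairings in degree four, one yields the product of the traces; the other two
    both yield [\tr (Ap *m Am)], because [Q] and hence its adjugates are symmetric. The factor
    [16^-1] undoes the scaling built into [goe_op]. *)
Lemma border_sum_moment (mu : seq nat -> K) :
  mu [::] = 1 -> mu [:: n] = 0 -> mu [:: n; n] = 1 ->
  (forall i j : 'I_n, mu [:: i : nat; j : nat] = 2^-1 * (i == j)%:R) ->
  (forall i j : 'I_n, mu [:: n; i : nat; j : nat] = 0) ->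
  (forall i j k l : 'I_n, mu [:: i : nat; j : nat; k : nat; l : nat] =
     4^-1 * ((i == j) && (k == l) + (i == k) && (j == l) + (i == l) && (j == k))%:R) ->
  border_sum (fun s => (mu s)%:P%:P) =
  (16^-1)%:P%:P * (goe_step (sqcharpoly Q) \Po 'X^2).
Proof.
move=> mu0 mu1 mu2 mu2' mu3 mu4.
have AmT i j : Am i j = Am j i.
  have AT : (\adj (char_poly_mx Q))^T = \adj (char_poly_mx Q).
    by rewrite trmx_adj raddfB /= tr_scalar_mx map_trmx Qsym.
  by rewrite [LHS]mxE [RHS]mxE -[in LHS]AT [in LHS]mxE.
have half : (2^-1 : K)%:P%:P = (16^-1)%:P%:P *+ 8 :> {poly {poly K}}.
  by rewrite -!rmorphMn /=; congr (_%:P%:P); field.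
have quart : (4^-1 : K)%:P%:P = (16^-1)%:P%:P *+ 4 :> {poly {poly K}}.
  by rewrite -!rmorphMn /=; congr (_%:P%:P); field.
have one : 1 = (16^-1)%:P%:P *+ 16 :> {poly {poly K}}.
  by rewrite -!rmorphMn /= -polyC1 -polyC1; congr (_%:P%:P); field.
rewrite goe_step_sqcharpoly /border_sum mu0 mu1 mu2.
have -> : \sum_(i < n) \sum_(j < n) (- ((x + y) * sp * Am i j + (x - y) * sm * Ap i j)) *
    (mu [:: i : nat; j : nat])%:P%:P =
    - ((16^-1)%:P%:P *+ 8 * ((x + y) * sp * \tr Am + (x - y) * sm * \tr Ap)).
  rewrite -half /mxtrace !mulr_sumr -big_split mulr_sumr -sumrN.
  apply: eq_bigr => i _ /=.
  rewrite (bigD1 i) //= big1 ?addr0 => [|j ji]; rewrite mu2'.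
    by rewrite eqxx mulr1; ring.
  by rewrite eq_sym (negbTE ji) mulr0 !polyC0 mulr0.
have -> : \sum_(i < n) \sum_(j < n) (sp * Am i j + sm * Ap i j) *
    (mu [:: n; i : nat; j : nat])%:P%:P = 0.
  apply: big1 => i _; apply: big1 => j _.
  by rewrite mu3 !polyC0 mulr0.
have -> : \sum_(i < n) \sum_(j < n) \sum_(k < n) \sum_(l < n)
      Ap i j * Am k l * (mu [:: i : nat; j : nat; k : nat; l : nat])%:P%:P =
    (16^-1)%:P%:P *+ 4 * (\tr Ap * \tr Am + \tr (Ap *m Am) *+ 2).
  transitivity (\sum_(i < n) \sum_(j < n)
      (4^-1 : K)%:P%:P * (Ap i j * ((i == j)%:R * \tr Am + Am j i *+ 2))).
    apply: eq_bigr => i _; apply: eq_bigr => j _.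
    pose c k l : {poly {poly K}} := ((i == j) && (k == l))%:R
      + ((i == k) && (j == l))%:R + ((i == l) && (j == k))%:R.
    transitivity ((4^-1 : K)%:P%:P * (Ap i j * \sum_(k < n) \sum_(l < n) c k l * Am k l)).
      rewrite !mulr_sumr; apply: eq_bigr => k _; rewrite !mulr_sumr; apply: eq_bigr => l _.
      rewrite mu4 !polyCM !polyC_natr /c !natrD; ring.
    congr (_ * (_ * _)).
    have d1 (a b : 'I_n) : \sum_(k < n) \sum_(l < n) ((a == k) && (b == l))%:R * Am k l = Am a b.
      rewrite (bigD1 a) //= [X in _ + X]big1 ?addr0 => [|k ka]; last first.
        by apply: big1 => l _; rewrite eq_sym (negbTE ka) mul0r.
      rewrite (bigD1 b) //= [X in _ + X]big1 ?addr0 => [|l lb]; last first.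
        by rewrite eqxx eq_sym (negbTE lb) mul0r.
      by rewrite !eqxx mul1r.
    transitivity (\sum_(k < n) \sum_(l < n) ((i == j) && (k == l))%:R * Am k l
      + \sum_(k < n) \sum_(l < n) ((i == k) && (j == l))%:R * Am k l
      + \sum_(k < n) \sum_(l < n) ((j == k) && (i == l))%:R * Am k l).
      rewrite -!big_split; apply: eq_bigr => k _; rewrite -!big_split.
      by apply: eq_bigr => l _ /=; rewrite /c [(i == l) && _]andbC; ring.
    rewrite !d1 -addrA; congr (_ + _); last by rewrite AmT mulr2n.
    rewrite /mxtrace mulr_sumr; apply: eq_bigr => k _.
    rewrite (bigD1 k) //= big1 ?addr0 => [|l lk]; first by rewrite eqxx andbT.
    by rewrite [k == l]eq_sym (negbTE lk) andbF mul0r.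
  rewrite -quart; transitivity ((4^-1 : K)%:P%:P * \sum_(i < n) \sum_(j < n)
      Ap i j * ((i == j)%:R * \tr Am + Am j i *+ 2)).
    by rewrite mulr_sumr; apply: eq_bigr => i _; rewrite mulr_sumr.
  congr (_ * _).
  transitivity (\sum_(i < n) (Ap i i * \tr Am + (Ap *m Am) i i *+ 2)).
    apply: eq_bigr => i _; rewrite [(Ap *m Am) i i]mxE -sumrMnl.
    under eq_bigr do rewrite mulrDr mulrnAr.
    rewrite big_split /=; congr (_ + _).
    rewrite (bigD1 i) //= big1 ?addr0 => [|j ji]; first by rewrite eqxx mul1r.
    by rewrite eq_sym (negbTE ji) mul0r mulr0.
  by rewrite big_split /= -mulr_suml sumrMnl.
rewrite !polyC0 !polyC1 mulr0 !addr0 !mulr1.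
rewrite -[(x + y) * (x - y) * sp * sm]mul1r -[sp * sm]mul1r [in LHS]one.
ring.
Qed.

End ColumnExpectation.

Lemma even_polyCM (K : numFieldType) (c : K) (F : {poly {poly K}}) :
  even_poly (c%:P%:P * F) = c%:P%:P * even_poly F.
Proof. by rewrite !mul_polyC even_polyZ. Qed.

Lemma even_poly_compX2 (K : numFieldType) (F : {poly {poly K}}) :
  even_poly (F \Po 'X^2) = F.
Proof.
apply/polyP=> i; rewrite coef_even_poly coef_comp_poly_Xn // -muln2.
by rewrite dvdn_mull // mulnK.
Qed.

End BivariateOperators.

(** * Improper integrals, the Gaussian integral and the Gaussian moments *)

Module GaussianIntegrals.
From Stdlib Require Import Lra Lia.
From Coquelicot Require Import Coquelicot.
Local Open Scope R_scope.

Lemma IntR_RInt (f : R -> R) (l : R) :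
  IntR f l <-> (forall a b, ex_RInt f a b) /\
    forall eps, 0 < eps -> exists M, forall a b,
      a <= - M -> M <= b -> Rabs (RInt f a b - l) < eps.
Proof.
split; intros [Hi Hl]; split.
- intros a b; destruct (Hi a b) as [pr]; exact (ex_RInt_Reals_1 _ _ _ pr).
- intros eps He; destruct (Hl eps He) as [M HM]; exists M; intros a b Ha Hb.
  destruct (Hi a b) as [pr]; rewrite (RInt_Reals _ _ _ pr); auto.
- intros a b; constructor; apply ex_RInt_Reals_0, Hi.
- intros eps He; destruct (Hl eps He) as [M HM]; exists M; intros a b Ha Hb pr.
  rewrite <- RInt_Reals; auto.
Qed.

Lemma IntR_ext (f g : R -> R) (l : R) :
  (forall x, f x = g x) -> IntR f l -> IntR g l.
Proof.
intros H; rewrite !IntR_RInt; intros [Hi Hl]; split.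
- intros a b; apply ex_RInt_ext with f; auto.
- intros eps He; destruct (Hl eps He) as [M HM]; exists M; intros a b Ha Hb.
  rewrite <- (RInt_ext f); auto.
Qed.

Lemma IntR_plus (f g : R -> R) (l m : R) :
  IntR f l -> IntR g m -> IntR (fun x => f x + g x) (l + m).
Proof.
rewrite !IntR_RInt; intros [Hf Lf] [Hg Lg]; split.
- intros a b; exact (ex_RInt_plus f g a b (Hf a b) (Hg a b)).
- intros eps He.
  destruct (Lf (eps / 2)) as [M1 H1]; [lra|].
  destruct (Lg (eps / 2)) as [M2 H2]; [lra|].
  exists (Rmax M1 M2); intros a b Ha Hb.
  pose proof (Rmax_l M1 M2); pose proof (Rmax_r M1 M2).
  replace (RInt (fun x => f x + g x) a b) with (RInt f a b + RInt g a b)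
    by (symmetry; exact (RInt_plus f g a b (Hf a b) (Hg a b))).
  replace (RInt f a b + RInt g a b - (l + m))
    with ((RInt f a b - l) + (RInt g a b - m)) by ring.
  apply Rle_lt_trans with (1 := Rabs_triang _ _).
  specialize (H1 a b ltac:(lra) ltac:(lra)).
  specialize (H2 a b ltac:(lra) ltac:(lra)); lra.
Qed.

Lemma IntR_scal (c : R) (f : R -> R) (l : R) :
  IntR f l -> IntR (fun x => c * f x) (c * l).
Proof.
rewrite !IntR_RInt; intros [Hf Lf]; split.
- intros a b; exact (ex_RInt_scal f a b c (Hf a b)).
- intros eps He.
  assert (Hc : 0 < Rabs c + 1) by (pose proof (Rabs_pos c); lra).
  destruct (Lf (eps / (Rabs c + 1))) as [M HM]; [now apply Rdiv_lt_0_compat|].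
  exists M; intros a b Ha Hb; specialize (HM a b Ha Hb).
  replace (RInt (fun x => c * f x) a b) with (c * RInt f a b)
    by (symmetry; exact (RInt_scal f a b c (Hf a b))).
  rewrite <- Rmult_minus_distr_l, Rabs_mult.
  apply Rle_lt_trans with ((Rabs c + 1) * Rabs (RInt f a b - l)).
  + apply Rmult_le_compat_r; [apply Rabs_pos | lra].
  + apply Rlt_le_trans with ((Rabs c + 1) * (eps / (Rabs c + 1))).
    * now apply Rmult_lt_compat_l.
    * right; field; lra.
Qed.

Lemma IntR_derive (F f : R -> R) (l m : R) :
  (forall x, is_derive F x (f x)) -> (forall x, continuous f x) ->
  is_lim F p_infty l -> is_lim F m_infty m -> IntR f (l - m).
Proof.
intros HF Hc Hl Hm; apply IntR_RInt.
assert (HI : forall a b, is_RInt f a b (F b - F a)).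
{ intros a b; apply (is_RInt_derive F f); auto. }
split.
- intros a b; eexists; apply HI.
- intros eps He; set (e2 := mkposreal (eps / 2) ltac:(lra)).
  apply is_lim_spec in Hl; destruct (Hl e2) as [M1 H1].
  apply is_lim_spec in Hm; destruct (Hm e2) as [M2 H2].
  exists (Rmax (M1 + 1) (- M2 + 1)); intros a b Ha Hb.
  pose proof (Rmax_l (M1 + 1) (- M2 + 1)); pose proof (Rmax_r (M1 + 1) (- M2 + 1)).
  rewrite (is_RInt_unique _ _ _ _ (HI a b)).
  specialize (H1 b ltac:(lra)); specialize (H2 a ltac:(lra)); simpl in H1, H2.
  apply Rabs_def2 in H1; apply Rabs_def2 in H2; apply Rabs_def1; lra.
Qed.

Lemma IntR_comp_scale (c : R) (f : R -> R) (l : R) :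
  0 < c -> IntR f l -> IntR (fun x => f (c * x)) (l / c).
Proof.
intros Hc; rewrite !IntR_RInt; intros [Hf Lf].
assert (HI : forall a b, is_RInt (fun x => f (c * x)) a b (RInt f (c * a) (c * b) / c)).
{ intros a b.
  assert (H := is_RInt_comp_lin f c 0 a b (RInt f (c * a) (c * b))).
  rewrite !Rplus_0_r in H.
  specialize (H (RInt_correct f _ _ (Hf _ _))).
  apply (is_RInt_scal _ _ _ (/ c)) in H.
  unfold Rdiv; rewrite Rmult_comm.
  refine (is_RInt_ext _ _ _ _ _ _ H).
  intros x _; rewrite Rplus_0_r; unfold scal; simpl; unfold mult; simpl.
  field; lra. }
split.
- intros a b; eexists; apply HI.
- intros eps He; destruct (Lf (c * eps)) as [M HM]; [nra|].
  exists (M / c); intros a b Ha Hb; rewrite (is_RInt_unique _ _ _ _ (HI a b)).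
  assert (E : c * (M / c) = M) by (field; lra).
  assert (H : Rabs (RInt f (c * a) (c * b) - l) < c * eps) by (apply HM; nra).
  replace (RInt f (c * a) (c * b) / c - l / c)
    with ((RInt f (c * a) (c * b) - l) / c) by (field; lra).
  unfold Rdiv; rewrite Rabs_mult, (Rabs_pos_eq (/ c))
    by (left; now apply Rinv_0_lt_compat).
  apply Rmult_lt_reg_l with c; [assumption|].
  replace (c * (Rabs (RInt f (c * a) (c * b) - l) * / c))
    with (Rabs (RInt f (c * a) (c * b) - l)) by (field; lra).
  assumption.
Qed.

(** Raise [1 + u <= exp u] at [u = c t^2 / (n + 1)] to the power [n + 1]: the resulting
    [|t|^(2 n + 2)] absorbs [|t|^n] and leaves at least one factor [|t|] in the denominator. *)
Lemma pow_exp_neg_sq_bound (c : R) (n : nat) (t : R) : 0 < c -> 1 <= Rabs t ->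
  Rabs (t ^ n * exp (- (c * t ^ 2))) <= ((INR n + 1) / c) ^ (n + 1) / Rabs t.
Proof.
intros Hc Ht.
assert (Hn : 0 < INR n + 1) by (pose proof (pos_INR n); lra).
assert (Hs : 1 <= t ^ 2) by (rewrite <- (pow2_abs t); nra).
set (s := c * t ^ 2); assert (Hs0 : 0 < s) by (unfold s; nra).
assert (He : (s / (INR n + 1)) ^ (n + 1) <= exp s).
{ replace (exp s) with (exp (s / (INR n + 1)) ^ (n + 1)).
  - apply pow_incr; split; [left; now apply Rdiv_lt_0_compat|].
    pose proof (exp_ineq1_le (s / (INR n + 1))); lra.
  - rewrite <- Rpower_pow by apply exp_pos; unfold Rpower; rewrite ln_exp.
    f_equal; rewrite plus_INR; simpl; field; lra. }
rewrite Rabs_mult, (Rabs_pos_eq (exp _)) by (left; apply exp_pos).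
rewrite exp_Ropp, <- RPow_abs.
assert (Hq : / exp s <= ((INR n + 1) / s) ^ (n + 1)).
{ replace ((INR n + 1) / s) with (/ (s / (INR n + 1))) by (field; lra).
  rewrite pow_inv; apply Rinv_le_contravar; [|exact He].
  apply pow_lt; now apply Rdiv_lt_0_compat. }
apply Rle_trans with (Rabs t ^ n * ((INR n + 1) / s) ^ (n + 1)).
{ apply Rmult_le_compat_l; [apply pow_le, Rabs_pos | exact Hq]. }
unfold s; rewrite <- (pow2_abs t).
replace ((INR n + 1) / (c * Rabs t ^ 2)) with ((INR n + 1) / c * / Rabs t ^ 2)
  by (field; split; lra).
rewrite Rpow_mult_distr.
replace (Rabs t ^ n * (((INR n + 1) / c) ^ (n + 1) * (/ Rabs t ^ 2) ^ (n + 1)))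
  with (((INR n + 1) / c) ^ (n + 1) * (Rabs t ^ n * (/ Rabs t ^ 2) ^ (n + 1))) by ring.
apply Rmult_le_compat_l.
{ apply pow_le; left; now apply Rdiv_lt_0_compat. }
rewrite pow_inv, <- pow_mult.
replace (2 * (n + 1))%nat with (n + (n + 1) + 1)%nat by lia.
rewrite !(pow_add _ _ 1), pow_1, pow_add.
assert (H1 : 1 <= Rabs t ^ n) by now apply pow_R1_Rle.
replace (Rabs t ^ n * / (Rabs t ^ n * Rabs t ^ (n + 1) * Rabs t))
  with (/ Rabs t * / Rabs t ^ (n + 1)).
2:{ field; repeat split; try lra; apply pow_nonzero; lra. }
rewrite <- (Rmult_1_r (/ Rabs t)) at 2.
apply Rmult_le_compat_l; [left; apply Rinv_0_lt_compat; lra|].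
rewrite <- Rinv_1; apply Rinv_le_contravar; [lra|].
now apply pow_R1_Rle.
Qed.

Lemma is_lim_pow_exp_neg_sq (c : R) (n : nat) : 0 < c ->
  is_lim (fun t => t ^ n * exp (- (c * t ^ 2))) p_infty 0 /\
  is_lim (fun t => t ^ n * exp (- (c * t ^ 2))) m_infty 0.
Proof.
intros Hc; set (C := ((INR n + 1) / c) ^ (n + 1)).
assert (HC : 0 < C).
{ apply pow_lt, Rdiv_lt_0_compat; [pose proof (pos_INR n); lra | assumption]. }
assert (H : forall eps : posreal, forall t, Rmax 1 (C / eps) < Rabs t ->
  Rabs (t ^ n * exp (- (c * t ^ 2)) - 0) < eps).
{ intros [eps He] t; simpl; intros Ht.
  pose proof (Rmax_l 1 (C / eps)); pose proof (Rmax_r 1 (C / eps)).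
  rewrite Rminus_0_r.
  apply Rle_lt_trans with (1 := pow_exp_neg_sq_bound c n t Hc ltac:(lra)).
  fold C; apply Rmult_lt_reg_r with (Rabs t); [lra|].
  replace (C / Rabs t * Rabs t) with C by (field; lra).
  apply Rle_lt_trans with (eps * (C / eps)); [right; field; lra|].
  apply Rmult_lt_compat_l; lra. }
split; apply is_lim_spec; intros eps.
- exists (Rmax 1 (C / eps)); intros x Hx; apply H.
  rewrite Rabs_pos_eq; [assumption | pose proof (Rmax_l 1 (C / eps)); lra].
- exists (- Rmax 1 (C / eps)); intros x Hx; apply H.
  pose proof (Rmax_l 1 (C / eps)); rewrite Rabs_left; lra.
Qed.

(* [half_gauss x ^ 2 + gauss_param x] does not depend on [x]; comparing [x = 0]
   with [x = +oo] gives the Gaussian integral. *)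
Definition half_gauss (x : R) : R := RInt (fun t => exp (- t ^ 2)) 0 x.
Definition gauss_kernel (x t : R) : R := exp (- (x ^ 2 * (1 + t ^ 2))) / (1 + t ^ 2).
Definition gauss_param (x : R) : R := RInt (gauss_kernel x) 0 1.

Lemma continuous_exp_neg_sq (t : R) : continuous (fun t => exp (- t ^ 2)) t.
Proof.
apply (ex_derive_continuous (fun t : R => exp (- t ^ 2))); auto_derive; auto.
Qed.

Lemma is_derive_half_gauss (x : R) : is_derive half_gauss x (exp (- x ^ 2)).
Proof.
apply (is_derive_RInt (fun t => exp (- t ^ 2)) half_gauss 0 x).
- apply filter_forall; intros y; apply (RInt_correct (V := R_CompleteNormedModule)).
  apply (ex_RInt_continuous (V := R_CompleteNormedModule)).
  intros; apply continuous_exp_neg_sq.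
- apply continuous_exp_neg_sq.
Qed.

Lemma ex_RInt_gauss_kernel (x a b : R) : ex_RInt (gauss_kernel x) a b.
Proof.
apply (ex_RInt_continuous (V := R_CompleteNormedModule)); intros t _.
apply (ex_derive_continuous (gauss_kernel x)); unfold gauss_kernel; auto_derive.
repeat split; nra.
Qed.

Lemma is_derive_gauss_kernel (x t : R) :
  is_derive (fun x => gauss_kernel x t) x (- 2 * x * exp (- (x ^ 2 * (1 + t ^ 2)))).
Proof.
unfold gauss_kernel; auto_derive; auto; simpl; field; nra.
Qed.

Lemma is_derive_gauss_param (x : R) : is_derive gauss_param x (- 2 * exp (- x ^ 2) * half_gauss x).
Proof.
assert (H : is_derive gauss_param x (RInt (fun t => Derive (fun x => gauss_kernel x t) x) 0 1)).
{ apply is_derive_RInt_param.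
  - apply filter_forall; intros y t _; eexists; apply is_derive_gauss_kernel.
  - intros t _.
    apply continuity_2d_pt_ext with
      (fun u v => - 2 * u * exp (- (u ^ 2 * (1 + v ^ 2)))).
    { intros u v; symmetry; apply is_derive_unique, is_derive_gauss_kernel. }
    apply continuity_2d_pt_mult.
    + apply continuity_2d_pt_mult; [apply continuity_2d_pt_const | apply continuity_2d_pt_id1].
    + apply (continuity_1d_2d_pt_comp exp).
      * apply derivable_continuous_pt, derivable_pt_exp.
      * apply continuity_2d_pt_opp, continuity_2d_pt_mult.
        -- apply (continuity_1d_2d_pt_comp (fun u => u ^ 2)); [|apply continuity_2d_pt_id1].
           apply derivable_continuous_pt, derivable_pt_pow.
        -- apply continuity_2d_pt_plus; [apply continuity_2d_pt_const|].
           apply (continuity_1d_2d_pt_comp (fun u => u ^ 2)); [|apply continuity_2d_pt_id2].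
           apply derivable_continuous_pt, derivable_pt_pow.
  - apply filter_forall; intros y; apply ex_RInt_gauss_kernel. }
replace (- 2 * exp (- x ^ 2) * half_gauss x)
  with (RInt (fun t => Derive (fun x => gauss_kernel x t) x) 0 1); [exact H|].
(* Factoring [exp (- x^2)] out leaves the integrand of the substitution of [x * t] for [t], Jacobian
   [x] included; this form is valid at [x = 0] as well. *)
rewrite (RInt_ext _ (fun t => scal (- 2 * exp (- x ^ 2)) (scal x (exp (- (x * t + 0) ^ 2))))).
2:{ intros t _; etransitivity; [apply is_derive_unique, is_derive_gauss_kernel|].
    unfold scal; simpl; unfold mult; simpl.
    replace (- (x * (x * 1) * (1 + t * (t * 1))))
      with (- (x * (x * 1)) + - ((x * t + 0) * ((x * t + 0) * 1))) by ring.
    rewrite exp_plus; ring. }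
assert (E : forall a b, ex_RInt (fun t => exp (- t ^ 2)) a b).
{ intros; apply (ex_RInt_continuous (V := R_CompleteNormedModule)).
  intros; apply continuous_exp_neg_sq. }
etransitivity; [apply (RInt_scal (V := R_CompleteNormedModule))|].
2:{ etransitivity; [apply f_equal, (RInt_comp_lin (fun t => exp (- t ^ 2)) x 0 0 1), E|].
  unfold half_gauss; rewrite !Rplus_0_r, Rmult_0_r, Rmult_1_r; reflexivity. }
apply (ex_RInt_comp_lin (fun t => exp (- t ^ 2))), E.
Qed.

Lemma half_gauss_sq_plus_param (x : R) : half_gauss x ^ 2 + gauss_param x = PI / 4.
Proof.
assert (D : forall y, is_derive (fun x => half_gauss x ^ 2 + gauss_param x) y 0).
{ intros y; replace 0 with
    (INR 2 * exp (- y ^ 2) * half_gauss y ^ pred 2 + - 2 * exp (- y ^ 2) * half_gauss y)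
    by (simpl; ring).
  apply (is_derive_plus (fun x => half_gauss x ^ 2) gauss_param).
  - apply is_derive_pow, is_derive_half_gauss.
  - apply is_derive_gauss_param. }
assert (E : half_gauss x ^ 2 + gauss_param x = half_gauss 0 ^ 2 + gauss_param 0).
{ destruct (MVT_gen (fun x => half_gauss x ^ 2 + gauss_param x) 0 x (fun _ => 0)) as [z [_ Hz]].
  - intros; apply D.
  - intros y _; apply continuity_pt_filterlim.
    apply (ex_derive_continuous (fun x => half_gauss x ^ 2 + gauss_param x)); eexists; apply D.
  - lra. }
rewrite E; unfold half_gauss, gauss_param; rewrite RInt_point.
unfold zero; simpl pow; simpl; rewrite Rmult_0_l, Rplus_0_l.
apply is_RInt_unique.
replace (PI / 4) with (minus (atan 1) (atan 0)).
2:{ rewrite atan_1, atan_0; apply Rminus_0_r. }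
apply is_RInt_ext with (fun t => / (1 + t ^ 2)).
{ intros t _; unfold gauss_kernel; rewrite pow_i, Rmult_0_l, Ropp_0, exp_0 by lia.
  symmetry; apply Rmult_1_l. }
apply (is_RInt_derive atan).
- intros t _; apply is_derive_Reals.
  apply derivable_pt_lim_atan.
- intros t _; apply (ex_derive_continuous (fun t : R => / (1 + t ^ 2))).
  auto_derive; nra.
Qed.

Lemma gauss_param_bounds (x : R) : 0 <= gauss_param x <= exp (- x ^ 2).
Proof.
assert (P : forall t, 0 < 1 + t ^ 2) by (intros t; nra).
split.
- apply RInt_ge_0; [lra | apply ex_RInt_gauss_kernel|].
  intros t _; unfold gauss_kernel; apply Rlt_le, Rdiv_lt_0_compat; [apply exp_pos | apply P].
- replace (exp (- x ^ 2)) with (RInt (fun _ => exp (- x ^ 2)) 0 1).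
  2:{ rewrite RInt_const; unfold scal; simpl; unfold mult; simpl; ring. }
  apply RInt_le; [lra | apply ex_RInt_gauss_kernel | apply ex_RInt_const |].
  intros t _; unfold gauss_kernel.
  apply Rle_trans with (exp (- x ^ 2) / 1).
  + apply Rmult_le_compat.
    * left; apply exp_pos.
    * left; apply Rinv_0_lt_compat, P.
    * destruct (Req_dec (x ^ 2 * t ^ 2) 0) as [Z|Z].
      -- right; f_equal; lra.
      -- left; apply exp_increasing; assert (0 <= x ^ 2 * t ^ 2) by nra; nra.
    * apply Rinv_le_contravar; [lra | nra].
  + right; field.
Qed.

Lemma is_lim_half_gauss : is_lim half_gauss p_infty (sqrt PI / 2).
Proof.
assert (Hp : forall x, 0 <= x -> 0 <= half_gauss x).
{ intros x Hx; apply RInt_ge_0; [assumption | |].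
  - apply (ex_RInt_continuous (V := R_CompleteNormedModule)).
    intros; apply continuous_exp_neg_sq.
  - intros; left; apply exp_pos. }
assert (HA : is_lim gauss_param p_infty 0).
{ apply is_lim_le_le_loc with (fun _ => 0) (fun x => x ^ 0 * exp (- (1 * x ^ 2))).
  - exists 0; intros x _; rewrite (Rmult_1_l (x ^ 2)), pow_O, Rmult_1_l.
    apply gauss_param_bounds.
  - apply is_lim_const.
  - apply (is_lim_pow_exp_neg_sq 1 0); lra. }
replace (sqrt PI / 2) with (sqrt (PI / 4 - 0)).
2:{ rewrite Rminus_0_r, sqrt_div_alt by lra.
    replace 4 with (2 * 2) by ring; rewrite sqrt_square; lra. }
apply is_lim_ext_loc with (fun x => sqrt (PI / 4 - gauss_param x)).
{ exists 0; intros x Hx; rewrite <- (half_gauss_sq_plus_param x).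
  replace (half_gauss x ^ 2 + gauss_param x - gauss_param x) with (half_gauss x ^ 2) by ring.
  apply sqrt_pow2, Hp; lra. }
apply (is_lim_comp_continuous (fun x => PI / 4 - gauss_param x) sqrt p_infty (PI / 4 - 0)).
- apply (is_lim_minus' (fun _ => PI / 4) gauss_param); [apply is_lim_const | exact HA].
- apply continuity_pt_filterlim, continuity_pt_sqrt; pose proof PI_RGT_0; lra.
Qed.

Lemma IntR_exp_neg_sq : IntR (fun t => exp (- t ^ 2)) (sqrt PI).
Proof.
replace (sqrt PI) with (sqrt PI / 2 - - (sqrt PI / 2)) by lra.
apply IntR_derive with half_gauss.
- exact is_derive_half_gauss.
- exact continuous_exp_neg_sq.
- exact is_lim_half_gauss.
(* [half_gauss] is odd, so the limit at minus infinity follows from the one at plus infinity. *)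
- apply is_lim_ext with (fun x => - half_gauss (- x)).
  { intros x; unfold half_gauss.
    assert (E : forall a b, ex_RInt (fun t => exp (- t ^ 2)) a b).
    { intros; apply (ex_RInt_continuous (V := R_CompleteNormedModule)).
      intros; apply continuous_exp_neg_sq. }
    assert (H := RInt_comp_lin (fun t => exp (- t ^ 2)) (-1) 0 0 x (E _ _)).
    replace (-1 * 0 + 0) with 0 in H by ring.
    replace (-1 * x + 0) with (- x) in H by ring.
    rewrite <- H; transitivity (- (-1 * RInt (fun t => exp (- t ^ 2)) 0 x)); [|ring].
    f_equal; etransitivity; [|apply (RInt_scal (V := R_CompleteNormedModule)), E].
    apply RInt_ext; intros t _; do 3 f_equal; ring. }
  apply (is_lim_opp (fun x => half_gauss (- x)) m_infty (sqrt PI / 2)).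
  apply (is_lim_comp half_gauss Ropp m_infty (sqrt PI / 2) p_infty).
  + exact is_lim_half_gauss.
  + apply (is_lim_opp (fun x => x) m_infty m_infty), is_lim_id.
  + exists 0; intros; discriminate.
Qed.

Definition gauss (s t : R) : R := exp (- (t ^ 2 / (2 * s))) / sqrt (2 * PI * s).

Fixpoint gauss_moment (s : R) (n : nat) : R :=
  match n with
  | 0 => 1
  | 1 => 0
  | S (S m) => s * INR (S m) * gauss_moment s m
  end.

Lemma IntR_pow_gauss (s : R) (n : nat) : 0 < s ->
  IntR (fun t => t ^ n * gauss s t) (gauss_moment s n).
Proof.
intros Hs; set (c := / (2 * s)).
assert (Hc : 0 < c) by (apply Rinv_0_lt_compat; lra).
assert (HP := PI_RGT_0).
assert (Hz : 0 < sqrt (2 * PI * s)) by (apply sqrt_lt_R0; nra).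
assert (D : forall t, exp (- (t ^ 2 / (2 * s))) = exp (- (c * t ^ 2))).
{ intros t; f_equal; unfold c; field; lra. }
assert (cont : forall m t, continuous (fun t => t ^ m * exp (- (c * t ^ 2))) t).
{ intros m t; apply (ex_derive_continuous (fun t : R => t ^ m * exp (- (c * t ^ 2)))).
  auto_derive; auto. }
assert (H01 : IntR (fun t => t ^ 0 * gauss s t) 1 /\ IntR (fun t => t ^ 1 * gauss s t) 0).
{ split.
  - replace 1 with (/ sqrt (2 * PI * s) * (sqrt PI / sqrt c)).
    2:{ unfold c; rewrite sqrt_inv; replace (2 * PI * s) with (PI * (2 * s)) by ring.
        rewrite sqrt_mult by lra.
        assert (0 < sqrt PI) by now apply sqrt_lt_R0.
        assert (0 < sqrt (2 * s)) by (apply sqrt_lt_R0; lra).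
        field; lra. }
    apply IntR_ext with (fun t => / sqrt (2 * PI * s) * exp (- (sqrt c * t) ^ 2)).
    { intros t; unfold gauss; rewrite D, Rpow_mult_distr, pow2_sqrt by lra.
      field; lra. }
    apply IntR_scal, (IntR_comp_scale (sqrt c) (fun t => exp (- t ^ 2))).
    + now apply sqrt_lt_R0.
    + apply IntR_exp_neg_sq.
  - replace 0 with (/ sqrt (2 * PI * s) * (- s * 0 - - s * 0)) by ring.
    apply IntR_ext with (fun t => / sqrt (2 * PI * s) * (t ^ 1 * exp (- (c * t ^ 2)))).
    { intros t; unfold gauss; rewrite D; field; lra. }
    apply IntR_scal, IntR_derive with (fun t => - s * (t ^ 0 * exp (- (c * t ^ 2)))).
    + intros t; auto_derive; auto; simpl; unfold c; field; lra.
    + apply cont.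
    + apply (is_lim_scal_l _ (- s) p_infty 0), is_lim_pow_exp_neg_sq, Hc.
    + apply (is_lim_scal_l _ (- s) m_infty 0), is_lim_pow_exp_neg_sq, Hc. }
assert (HS : forall m l, IntR (fun t => t ^ m * gauss s t) l ->
  IntR (fun t => t ^ (S (S m)) * gauss s t) (s * INR (S m) * l)).
{ intros m l Hl.
  replace (s * INR (S m) * l) with
    (- s / sqrt (2 * PI * s) * (0 - 0) + s * INR (S m) * l) by (field; lra).
  (* Integration by parts: [t^(m+2) gauss s t] is [- s] times the derivative of [t^(m+1) gauss s t],
     plus [s (m+1) t^m gauss s t]. The vanishing boundary values are the two zeros of [0 - 0]. *)
  apply IntR_ext with (fun t =>
    - s / sqrt (2 * PI * s) * (INR (S m) * (t ^ m * exp (- (c * t ^ 2)))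
      + - / s * (t ^ (S (S m)) * exp (- (c * t ^ 2))))
    + s * INR (S m) * (t ^ m * gauss s t)).
  { intros t; unfold gauss; rewrite D; simpl pow; field; lra. }
  apply IntR_plus; [|now apply IntR_scal].
  apply IntR_scal, IntR_derive with (fun t => t ^ (S m) * exp (- (c * t ^ 2))).
  - intros t; auto_derive; auto.
    change (1 * (INR (S m) * t ^ m) * exp (- (c * t ^ 2))
      + t * t ^ m * (- (c * (1 * ((1 + 1) * (t * 1)))) * exp (- (c * t ^ 2)))
      = INR (S m) * (t ^ m * exp (- (c * t ^ 2)))
        + - / s * (t * (t * t ^ m) * exp (- (c * t ^ 2)))).
    unfold c; field; lra.
  - intros t.
    apply (ex_derive_continuous (fun t : R => INR (S m) * (t ^ m * exp (- (c * t ^ 2)))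
      + - / s * (t ^ (S (S m)) * exp (- (c * t ^ 2))))); auto_derive; auto.
  - apply is_lim_pow_exp_neg_sq, Hc.
  - apply is_lim_pow_exp_neg_sq, Hc. }
(* The recursion skips one exponent, so two consecutive moments are carried through the
   induction. *)
assert (H : IntR (fun t => t ^ n * gauss s t) (gauss_moment s n) /\
            IntR (fun t => t ^ (S n) * gauss s t) (gauss_moment s (S n))).
{ induction n as [|n [IH1 IH2]]; [exact H01|].
  split; [exact IH2 | exact (HS n _ IH1)]. }
apply H.
Qed.

(** * Iterated integrals and the coordinates of symmetric matrices *)

Lemma IntRn_ext (n : nat) (F G : (nat -> R) -> R) (l : R) :
  (forall v, F v = G v) -> IntRn n F l -> IntRn n G l.
Proof.
revert F G l; induction n as [|n IH]; simpl; intros F G l H.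
- now rewrite H.
- intros [g [Hg Hl]]; exists g; split; [|assumption].
  intros x; apply IH with (2 := Hg x); intros v; apply H.
Qed.

Lemma IntRn_plus (n : nat) (F G : (nat -> R) -> R) (l m : R) :
  IntRn n F l -> IntRn n G m -> IntRn n (fun v => F v + G v) (l + m).
Proof.
revert F G l m; induction n as [|n IH]; simpl; intros F G l m.
- now intros -> ->.
- intros [f [Hf Hl]] [g [Hg Hm]]; exists (fun x => f x + g x); split.
  + intros x; exact (IH _ _ _ _ (Hf x) (Hg x)).
  + now apply IntR_plus.
Qed.

Lemma IntRn_scal (n : nat) (c : R) (F : (nat -> R) -> R) (l : R) :
  IntRn n F l -> IntRn n (fun v => c * F v) (c * l).
Proof.
revert F l; induction n as [|n IH]; simpl; intros F l.
- now intros ->.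
- intros [f [Hf Hl]]; exists (fun x => c * f x); split.
  + intros x; exact (IH _ _ (Hf x)).
  + now apply IntR_scal.
Qed.

Definition vapp (m : nat) (v w : nat -> R) : nat -> R :=
  fun i => if (i <? m)%nat then v i else w (i - m)%nat.

(** [symidx] numbers the upper triangle column by column, so the border of a matrix occupies the
    last coordinates, which [IntRn] integrates innermost. Averaging over the border before the old
    matrix therefore respects the prescribed order of integration. *)
Lemma IntRn_app (m n : nat) (F G : (nat -> R) -> R) (l : R) :
  (forall v, IntRn n (fun w => F (vapp m v w)) (G v)) ->
  IntRn m G l -> IntRn (m + n) F l.
Proof.
revert F G l; induction m as [|m IH]; simpl; intros F G l HF HG.
- subst l; refine (IntRn_ext _ _ _ _ _ (HF (fun _ => 0))).
  intros w; f_equal; apply FunctionalExtensionality.functional_extensionality.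
  intros i; unfold vapp; simpl; f_equal; lia.
- destruct HG as [g [Hg Hl]]; exists g; split; [|assumption].
  intros x; apply IH with (fun v => G (vcons x v)); [|apply Hg].
  intros v; refine (IntRn_ext _ _ _ _ _ (HF (vcons x v))).
  intros w; f_equal; apply FunctionalExtensionality.functional_extensionality.
  intros [|i]; unfold vapp; simpl; [reflexivity|].
  reflexivity.
Qed.

Lemma symdim_S (n : nat) : symdim (S n) = (symdim n + S n)%nat.
Proof.
unfold symdim; replace (S n * (S n + 1))%nat with (n * (n + 1) + S n * 2)%nat by ring.
now rewrite Nat.div_add by lia.
Qed.

Lemma symdim_add_lt (i j n : nat) : (i <= j)%nat -> (j < n)%nat -> (symdim j + i < symdim n)%nat.
Proof.
intros Hi Hj; induction Hj as [|n Hj IH]; rewrite symdim_S; lia.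
Qed.

Lemma symM_sym (v : nat -> R) (i j : nat) : symM v i j = symM v j i.
Proof.
unfold symM; destruct (Nat.leb_spec i j), (Nat.leb_spec j i); try lia; try reflexivity.
now replace i with j by lia.
Qed.

Lemma symM_vapp_old (n : nat) (v w : nat -> R) (i j : nat) : (i < n)%nat -> (j < n)%nat ->
  symM (vapp (symdim n) v w) i j = symM v i j.
Proof.
intros Hi Hj; unfold symM, vapp, symidx.
destruct (Nat.leb_spec i j) as [H|H].
- pose proof (symdim_add_lt i j n H Hj) as L; unfold symdim in L at 1.
  now apply Nat.ltb_lt in L; rewrite L.
- pose proof (symdim_add_lt j i n ltac:(lia) Hi) as L; unfold symdim in L at 1.
  now apply Nat.ltb_lt in L; rewrite L.
Qed.

Lemma symM_vapp_new (n : nat) (v w : nat -> R) (i : nat) : (i <= n)%nat ->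
  symM (vapp (symdim n) v w) i n = w i.
Proof.
intros Hi; unfold symM, symidx; rewrite (proj2 (Nat.leb_le i n) Hi).
change (n * (n + 1) / 2)%nat with (symdim n); unfold vapp.
rewrite (proj2 (Nat.ltb_ge (symdim n + i) (symdim n))) by lia; f_equal; lia.
Qed.

Lemma gauss_half (t : R) : gauss (/ 2) t = exp (- t ^ 2) / sqrt PI.
Proof.
unfold gauss; f_equal; [f_equal; field | do 2 f_equal; field].
Qed.

Lemma gauss_1 (t : R) : gauss 1 t = exp (- (t ^ 2 / 2)) / (sqrt 2 * sqrt PI).
Proof.
unfold gauss; rewrite !Rmult_1_r; f_equal; f_equal.
apply sqrt_mult; [lra | pose proof PI_RGT_0; lra].
Qed.

End GaussianIntegrals.

(** * Product weights and the moments of one Gaussian column *)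

Module GOEExpectation.
From Stdlib Require Import Lia.
From HB Require Import structures.
From mathcomp Require Import all_boot all_order all_algebra.
From mathcomp Require Import Rstruct.
From mathcomp Require Import ring zify.
Set Implicit Arguments. Unset Strict Implicit. Unset Printing Implicit Defensive.
Import GRing.Theory Num.Theory.
Import BivariateOperators GaussianIntegrals.
Local Open Scope ring_scope.

Lemma IntRn_prod n (f : nat -> R -> R) (l : nat -> R) :
  (forall i, IntR (f i) (l i)) ->
  IntRn n (fun v => \prod_(i < n) f i (v i)) (\prod_(i < n) l i).
Proof.
elim: n f l => [|n IHn] f l fl /=; first by rewrite !big_ord0.
exists (fun t => (\prod_(i < n) l i.+1) * f 0%N t); split=> [t|].
  apply: (@IntRn_ext _ (fun v => f 0%N t * \prod_(i < n) f i.+1 (v i))).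
    by move=> v; rewrite big_ord_recl.
  by rewrite mulrC; apply: IntRn_scal; apply: (IHn (fun i => f i.+1) (fun i => l i.+1)).
by rewrite big_ord_recl mulrC; apply: IntR_scal.
Qed.

Lemma INR_natr n : INR n = n%:R :> R.
Proof. by elim: n => // n IHn; rewrite S_INR IHn -natr1. Qed.

Lemma IntR_poly_gauss (s : R) (p : {poly R}) : Rlt 0 s ->
  IntR (fun t => p.[t] * gauss s t) (moment_fun (gauss_moment s) p).
Proof.
move=> s0; apply: (@IntR_ext (fun t => \sum_(i < size p) p`_i * (t ^+ i * gauss s t))).
  by move=> t; rewrite horner_coef mulr_suml; apply: eq_bigr => i _; rewrite mulrA.
rewrite /moment_fun; elim: (size p) => [|m IHm].
  (* The zero function is integrated as [0] times the zeroth moment integrand. *)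
  apply: (@IntR_ext (fun t => Rmult 0 (Rmult (pow t 0) (gauss s t)))).
    by move=> t; rewrite big_ord0 Rmult_0_l.
  rewrite big_ord0 -[X in IntR _ X](Rmult_0_l (gauss_moment s 0)).
  by apply: IntR_scal; apply: IntR_pow_gauss.
rewrite big_ord_recr; apply: (@IntR_ext (fun t => Rplus
    (\sum_(i < m) p`_i * (t ^+ i * gauss s t)) (Rmult p`_m (Rmult (pow t m) (gauss s t))))).
  by move=> t; rewrite big_ord_recr /= RpowE.
by apply: IntR_plus => //; apply: IntR_scal; apply: IntR_pow_gauss.
Qed.

Section GaussianColumn.
Variable n : nat.

(** The new column lists its [n] entries above the diagonal first; index [n] is the diagonal
    entry. *)
Definition col_var (i : nat) : R := if (i < n)%N then 2^-1 else 1.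

Definition col_weight (v : nat -> R) : R := \prod_(i < n.+1) gauss (col_var i) (v i).

Definition col_moment (s : seq nat) : R :=
  \prod_(t < n.+1) gauss_moment (col_var t) (count_mem (t : nat) s).

Lemma col_var_gt0 i : Rlt 0 (col_var i).
Proof.
rewrite /col_var; case: ifP => _; last exact: Rlt_0_1.
exact: (Rinv_0_lt_compat 2 Rlt_0_2).
Qed.

Lemma prod_countE (v : nat -> R) s : all (fun i => i < n.+1)%N s ->
  \prod_(i <- s) v i = \prod_(t < n.+1) v t ^+ count_mem (t : nat) s.
Proof.
elim: s => [|i s IHs] /=; first by rewrite big_nil big1 // => t _.
case/andP=> ilt /IHs IH; rewrite big_cons IH.
under [RHS]eq_bigr do rewrite exprD.
rewrite big_split /=; congr (_ * _).
rewrite (bigD1 (Ordinal ilt)) //= eqxx expr1 big1 ?mulr1 // => t.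
by rewrite -val_eqE /= eq_sym => /negbTE ->.
Qed.

Lemma IntRn_col_weight s : all (fun i => i < n.+1)%N s ->
  IntRn n.+1 (fun v => (\prod_(i <- s) v i) * col_weight v) (col_moment s).
Proof.
move=> sn; apply: (@IntRn_ext _ (fun v => \prod_(t < n.+1)
    (v t ^+ count_mem (t : nat) s * gauss (col_var t) (v t)))).
  by move=> v; rewrite (prod_countE v sn) -big_split.
apply: (@IntRn_prod n.+1 (fun t (x : R) => x ^+ count_mem t s * gauss (col_var t) x)
  (fun t => gauss_moment (col_var t) (count_mem t s))) => t.
apply: (@IntR_ext (fun x => Rmult (pow x (count_mem t s)) (gauss (col_var t) x))).
  by move=> x; rewrite RpowE.
by apply: IntR_pow_gauss; apply: col_var_gt0.
Qed.

Lemma col_moment_nil : col_moment [::] = 1.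
Proof. by rewrite /col_moment big1. Qed.

(** Wick's recursion: integration by parts in the variable [i] pairs the leading factor with each
    further occurrence of [i]. If there is none, the count is 0 and the product vanishes. *)
Lemma col_moment_cons i s : (i < n.+1)%N ->
  col_moment (i :: s) = col_var i * (count_mem i s)%:R * col_moment (rem i s).
Proof.
move=> ilt; rewrite /col_moment (bigD1 (Ordinal ilt)) //= [in RHS](bigD1 (Ordinal ilt)) //=.
rewrite eqxx add1n mulrA; congr (_ * _).
  rewrite count_rem /= eqxx andbT.
  case E : (count_mem i s) => [|c]; first by rewrite mulr0 mul0r.
  have -> : i \in s by rewrite -has_pred1 has_count E.
  by rewrite subn1 /= -INR_natr.
apply: eq_bigr => t; rewrite -val_eqE /= eq_sym => /negbTE ti.
by rewrite ti count_rem /= ti andbF subn0.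
Qed.

Lemma col_moment_last : col_moment [:: n] = 0.
Proof. by rewrite col_moment_cons //= mulr0 mul0r. Qed.

Lemma col_moment_last2 : col_moment [:: n; n] = 1.
Proof.
by rewrite col_moment_cons //= eqxx addn0 col_moment_nil /col_var ltnn !mulr1.
Qed.

Lemma col_moment2 i j : (i < n)%N -> col_moment [:: i; j] = 2^-1 * (i == j)%:R.
Proof.
move=> ilt; rewrite col_moment_cons ?leqW //= /col_var ilt addn0 eq_sym.
by case: eqP => _; rewrite ?mulr0 ?mul0r // col_moment_nil mulr1.
Qed.

Lemma col_moment_last_pair i j : (i < n)%N -> (j < n)%N -> col_moment [:: n; i; j] = 0.
Proof.
by move=> ilt jlt; rewrite col_moment_cons //= !ltn_eqF // mulr0 mul0r.
Qed.

Lemma col_moment4 i j k l : (i < n)%N -> (j < n)%N -> (k < n)%N ->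
  col_moment [:: i; j; k; l] = 4^-1 * ((i == j) && (k == l) + (i == k) && (j == l)
     + (i == l) && (j == k))%:R.
Proof.
move=> ilt jlt klt; rewrite col_moment_cons ?leqW //= /col_var ilt addn0.
have q : 2^-1 * 2^-1 = 4^-1 :> R by rewrite -invfM -natrM.
rewrite ![_ == i]eq_sym -q; case: (eqVneq i j) => [<-|ij] /=.
  rewrite col_moment2 //; case: (eqVneq k l) => [<-|kl] /=.
    by case: (i == k) => /=; ring.
  have : ~~ ((i == k) && (i == l)) by apply: contraNN kl => /andP[/eqP <-].
  by case: (i == k); case: (i == l) => //= _; ring.
case: (eqVneq i k) => [<-|ik] /=.
  rewrite col_moment2 //; case: (eqVneq i l) => [<-|il] /=.
    by rewrite ![_ == i]eq_sym (negbTE ij); ring.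
  by case: (j == l); ring.
case: (eqVneq i l) => [_|il] /=; last by ring.
by rewrite col_moment2 //; case: (j == k); ring.
Qed.

End GaussianColumn.

(* "The [W]-weighted integral of the polynomial-valued [f] is [E]", tested against
   all linear functionals. *)
Definition polyExp N (W : (nat -> R) -> R) (f : (nat -> R) -> {poly {poly R}})
    (E : {poly {poly R}}) : Prop :=
  forall L, klinear L -> IntRn N (fun v => L (f v) * W v) (L E).

(** * Linearity of polynomial-valued expectations *)

Section PolyExp.
Variables (N : nat) (W : (nat -> R) -> R).
Implicit Types (f g : (nat -> R) -> {poly {poly R}}) (E c : {poly {poly R}}).

Lemma polyExp_ext f g E : (forall v, f v = g v) -> polyExp N W f E -> polyExp N W g E.
Proof.
move=> fg fE L kL; apply: (@IntRn_ext _ (fun v => L (f v) * W v)); last exact: fE.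
by move=> v; rewrite fg.
Qed.

Lemma polyExpD f g E E' : polyExp N W f E -> polyExp N W g E' ->
  polyExp N W (fun v => f v + g v) (E + E').
Proof.
move=> fE gE L kL; rewrite kL.1.
apply: (@IntRn_ext _ (fun v => Rplus (L (f v) * W v) (L (g v) * W v))).
  by move=> v; rewrite kL.1 mulrDl.
by apply: IntRn_plus; [exact: fE | exact: gE].
Qed.

Lemma klinear_comp (L : {poly {poly R}} -> R) (h : {poly {poly R}} -> {poly {poly R}}) :
  klinear L -> (forall F G, h (F + G) = h F + h G) ->
  (forall (a : R) F, h (a%:P%:P * F) = a%:P%:P * h F) -> klinear (L \o h).
Proof.
by move=> [LD LZ] hD hZ; split=> [F G|c F] /=; rewrite ?hD ?LD ?hZ ?LZ.
Qed.

Lemma polyExp_comp h f E : (forall F G, h (F + G) = h F + h G) ->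
  (forall (a : R) F, h (a%:P%:P * F) = a%:P%:P * h F) ->
  polyExp N W f E -> polyExp N W (fun v => h (f v)) (h E).
Proof. by move=> hD hZ fE L kL; apply: (fE _ (klinear_comp kL hD hZ)). Qed.

Lemma polyExpM c f E : polyExp N W f E -> polyExp N W (fun v => c * f v) (c * E).
Proof.
by apply: (@polyExp_comp (fun F => c * F)) => [F G|a F]; rewrite ?mulrDr // mulrCA.
Qed.

Lemma polyExpC (m : (nat -> R) -> R) (e : R) : IntRn N (fun v => m v * W v) e ->
  polyExp N W (fun v => (m v)%:P%:P) e%:P%:P.
Proof.
move=> me L kL; have LC a : L a%:P%:P = L 1 * a by rewrite -[a%:P%:P]mulr1 kL.2 mulrC.
rewrite LC; apply: (@IntRn_ext _ (fun v => Rmult (L 1) (m v * W v))).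
  by move=> v; rewrite (LC (m v)) RmultE mulrA.
exact: IntRn_scal.
Qed.

Lemma polyExp_sum k (f : 'I_k -> (nat -> R) -> {poly {poly R}}) (E : 'I_k -> {poly {poly R}}) :
  IntRn N W 1 -> (forall i, polyExp N W (f i) (E i)) ->
  polyExp N W (fun v => \sum_i f i v) (\sum_i E i).
Proof.
move=> W1; elim: k f E => [|k IHk] f E fE.
  rewrite big_ord0; apply: (@polyExp_ext (fun v => 0 * 1%:P%:P)).
    by move=> v; rewrite big_ord0 mul0r.
  rewrite -[X in polyExp _ _ _ X](mul0r 1%:P%:P); apply: polyExpM; apply: polyExpC.
  by apply: (@IntRn_ext _ W) => // v; rewrite mul1r.
rewrite big_ord_recl; apply: (@polyExp_ext (fun v => f ord0 v + \sum_i f (lift ord0 i) v)).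
  by move=> v; rewrite big_ord_recl.
by apply: polyExpD => //; apply: IHk => i.
Qed.

End PolyExp.

(** * One bordering step in expectation *)

Lemma polyExp_border_sum n (Q : 'M[R]_n) :
  polyExp n.+1 (col_weight n) (fun v => border_sum Q (fun s => col_mono s v))
    (border_sum Q (fun s => (col_moment n s)%:P%:P)).
Proof.
have EC c s : all (fun i => i < n.+1)%N s ->
    polyExp n.+1 (col_weight n) (fun v => c * col_mono s v) (c * (col_moment n s)%:P%:P).
  by move=> sn; apply: polyExpM; apply: polyExpC; apply: IntRn_col_weight.
have W1 : IntRn n.+1 (col_weight n) 1.
  have -> : IZR 1 = col_moment n [::] by rewrite col_moment_nil.
  apply: (@IntRn_ext _ (fun v => (\prod_(i <- [::]) v i) * col_weight n v)).
    by move=> v; rewrite big_nil mul1r.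
  exact: IntRn_col_weight.
have lt (i : 'I_n) : (i < n.+1)%N by rewrite ltnS ltnW.
rewrite /border_sum.
apply: polyExpD; [apply: polyExpD; [apply: polyExpD;
  [apply: polyExpD; [apply: polyExpD |] |] |] |].
- exact: EC.
- by apply: EC; rewrite /= ltnSn.
- by apply: EC; rewrite /= ltnSn.
- apply: polyExp_sum => // i; apply: polyExp_sum => // j.
  by apply: EC; rewrite /= !lt.
- apply: polyExp_sum => // i; apply: polyExp_sum => // j.
  by apply: EC; rewrite /= !lt ltnS leqnn.
- apply: polyExp_sum => // i; apply: polyExp_sum => // j.
  apply: polyExp_sum => // k; apply: polyExp_sum => // l.
  by apply: EC; rewrite /= !lt.
Qed.

Lemma polyExp_sqcharpoly_bordered n (Q : 'M[R]_n) : Q^T = Q ->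
  polyExp n.+1 (col_weight n) (fun v => sqcharpoly (bordered Q v))
    ((16^-1)%:P%:P * goe_step (sqcharpoly Q)).
Proof.
(* [even_poly] undoes the substitution of ['X^2] and, being linear, commutes with the expectation;
   this carries the average from [charpoly2] in [y] over to [sqcharpoly] in [w]. *)
move=> Qsym; rewrite -(even_poly_compX2 (goe_step _)) -even_polyCM.
rewrite -(@border_sum_moment _ n Q Qsym (col_moment n)) //.
- have E : polyExp n.+1 (col_weight n) (fun v => charpoly2 (bordered Q v))
      (border_sum Q (fun s => (col_moment n s)%:P%:P)).
    apply: (@polyExp_ext _ _ (fun v => border_sum Q (fun s => col_mono s v))).
      by move=> v; rewrite charpoly2_bordered.
    exact: polyExp_border_sum.
  have D (F G : {poly {poly R}}) : even_poly (F + G) = even_poly F + even_poly G.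
    exact: even_polyD.
  exact: (polyExp_comp D (@even_polyCM R) E).
- exact: col_moment_nil.
- exact: col_moment_last.
- exact: col_moment_last2.
- by move=> i j; rewrite col_moment2.
- by move=> i j; rewrite col_moment_last_pair.
- by move=> i j k l; rewrite col_moment4.
Qed.

(** * Induction on the matrix size *)

Definition goe_matrix n (v : nat -> R) : 'M[R]_n := \matrix_(i < n, j < n) symM v i j.

(** The GOE density in a form that factors under bordering; [goe_densityE] identifies the two. *)
Fixpoint goe_weight n (v : nat -> R) : R :=
  if n is m.+1 then goe_weight m v * col_weight m (fun i => v (symdim m + i)%N) else 1.

Lemma goe_weight_vapp n v w : goe_weight n (vapp (symdim n) v w) = goe_weight n v.
Proof.
have ext v' : (forall i, (i < symdim n)%N -> v' i = v i) -> goe_weight n v' = goe_weight n v.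
  elim: n {w} => //= n IHn vv; rewrite IHn; last first.
    by move=> i ilt; apply: vv; rewrite symdim_S ltn_addr.
  congr (_ * _); rewrite /col_weight; apply: eq_bigr => i _.
  by rewrite vv // symdim_S ltn_add2l.
by apply: ext => i ilt; rewrite /vapp; have /Nat.ltb_lt -> : (i < symdim n)%coq_nat by lia.
Qed.

Lemma sqcharpoly_cast n m (e : n = m) (Q : 'M[R]_n) :
  sqcharpoly (castmx (e, e) Q) = sqcharpoly Q.
Proof. by case: m / e; rewrite castmx_id. Qed.

Lemma goe_matrix_vapp n v w :
  goe_matrix n.+1 (vapp (symdim n) v w) =
  castmx (addn1 n, addn1 n) (bordered (goe_matrix n v) w).
Proof.
apply/matrixP => i j; rewrite castmxE /bordered !mxE.
case: splitP => i' /= ii; rewrite mxE; case: splitP => j' /= jj; rewrite !mxE ii jj.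
- by rewrite symM_vapp_old //; apply/ltP.
- by rewrite ord1 addn0 symM_vapp_new //; apply/leP/ltnW.
- by rewrite ord1 addn0 symM_sym symM_vapp_new //; apply/leP/ltnW.
- by rewrite !ord1 /= !addn0 symM_vapp_new // mulr1n.
Qed.

Lemma polyExp_goe n :
  polyExp (symdim n) (goe_weight n) (fun v => sqcharpoly (goe_matrix n v))
    ((16^-1 ^+ n)%:P%:P * iter n (@goe_step R) 1).
Proof.
elim: n => [|n IHn] L kL.
  rewrite expr0 !polyC1 mulr1 /=; set F := sqcharpoly _.
  have -> : F = 1.
    rewrite /F /sqcharpoly /charpoly2 /char_poly det_mx00 !rmorph1 mulr1.
    by rewrite -polyC1 even_polyC.
  by rewrite mulr1.
(* Integrating the last column replaces [L] by [16^-1] times [L \o goe_step], so the induction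
   hypothesis is needed for a different functional; hence the quantification over all of them in
   [polyExp]. *)
have kS : klinear (fun F => 16^-1 * L (goe_step F)).
  split=> [F G|c F]; first by rewrite goe_stepD kL.1 mulrDr.
  by rewrite goe_stepZ kL.2 mulrCA.
rewrite symdim_S; apply: (@IntRn_app _ _ _
    (fun v => 16^-1 * L (goe_step (sqcharpoly (goe_matrix n v))) * goe_weight n v)).
  move=> v; apply: (@IntRn_ext _ (fun w => Rmult (goe_weight n v)
      (L (sqcharpoly (bordered (goe_matrix n v) w)) * col_weight n w))).
    move=> w; rewrite goe_matrix_vapp sqcharpoly_cast /= goe_weight_vapp RmultE mulrCA.
    congr (_ * (_ * _)); rewrite /col_weight; apply: eq_bigr => i _; congr (gauss _ _).
    rewrite /vapp; have /Nat.ltb_ge -> : (symdim n <= symdim n + i)%coq_nat by lia.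
    by congr w; lia.
  rewrite mulrC -kL.2; apply: IntRn_scal; apply: polyExp_sqcharpoly_bordered => //.
  by apply/matrixP => i j; rewrite !mxE symM_sym.
have -> : L ((16^-1 ^+ n.+1)%:P%:P * iter n.+1 (@goe_step R) 1) =
    16^-1 * L (goe_step ((16^-1 ^+ n)%:P%:P * iter n (@goe_step R) 1)).
  by rewrite goe_stepZ !kL.2 mulrA exprS.
exact: (IHn _ kS).
Qed.

(** * Identification with the stated determinant and density *)

Lemma sum_f_R0E (f : nat -> R) n : sum_f_R0 f n = \sum_(i < n.+1) f i.
Proof.
elim: n => [|n IHn] /=; first by rewrite big_ord_recr big_ord0 /= add0r.
by rewrite big_ord_recr /= IHn.
Qed.

Lemma detE n (M : nat -> nat -> R) : Defs.det n M = \det (\matrix_(i < n, j < n) M i j).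
Proof.
elim: n M => [|n IHn] M; first by rewrite det_mx00.
rewrite (expand_det_row _ ord0) /= sum_f_R0E; apply: eq_bigr => j _.
rewrite !mxE /cofactor add0n RmultE RmultE RpowE -mulrA mulrCA; congr (_ * (_ * _)).
rewrite IHn; congr (\det _); apply/matrixP => i k; rewrite !mxE /=.
congr M; rewrite /bump; case: Nat.ltb_spec => [/ltP kj|/leP jk].
  by rewrite leqNgt kj.
by rewrite jk.
Qed.

Lemma det_shift n v u : Defs.det n (shift (symM v) u) ^+ 2 = (char_poly (goe_matrix n v)).[u] ^+ 2.
Proof.
have -> : (char_poly (goe_matrix n v)).[u] = (-1) ^+ n * Defs.det n (shift (symM v) u).
  rewrite detE -detZ -[LHS]horner_evalE -det_map_mx; congr (\det _).
  apply/matrixP => i j; rewrite !mxE /= horner_evalE hornerD hornerN hornerC hornerMn hornerX.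
  rewrite /shift; case: Nat.eq_dec => [ij|ij].
    have -> : i = j by apply: val_inj.
    by rewrite eqxx mulr1n RminusE mulN1r opprB.
  have /negbTE -> : i != j by apply/eqP => e; apply: ij; rewrite e.
  by rewrite mulr0n Rminus_0_r mulN1r add0r.
by rewrite exprMn sqrr_sign mul1r.
Qed.

Lemma exp_addr (a b : R) : exp (a + b)%R = exp a * exp b.
Proof. exact: exp_plus. Qed.

Lemma sqrt_neq0 (a : R) : Rlt 0 a -> sqrt a != 0.
Proof. by move=> a0; apply/eqP => e; have := sqrt_lt_R0 a a0; rewrite e; apply: Rlt_irrefl. Qed.

Lemma prod_gauss_half n (w : nat -> R) :
  \prod_(i < n) gauss (2^-1)%R (w i) = exp (- \sum_(i < n) w i ^+ 2)%R / sqrt PI ^+ n.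
Proof.
elim: n => [|n IHn]; first by rewrite !big_ord0 oppr0 exp_0 expr0 divr1.
rewrite !big_ord_recr /= IHn (gauss_half (w n)) RpowE RdivE opprD exp_addr (exprSr (sqrt PI)) invfM.
by rewrite mulrACA.
Qed.

Lemma col_weightE n w : col_weight n w =
  exp (- (\sum_(i < n) w i ^+ 2 + 2^-1 * w n ^+ 2))%R / (sqrt (IZR 2) * sqrt PI ^+ n.+1).
Proof.
rewrite /col_weight big_ord_recr /= /col_var ltnn.
under eq_bigr do rewrite ltn_ord.
rewrite prod_gauss_half (gauss_1 (w n)) RpowE !RdivE opprD exp_addr.
rewrite RmultE [_ / IZR 2]mulrC (exprS (sqrt PI)) !invfM; have -> : (IZR 2)^-1 = 2^-1 :> R by [].
set a := exp _; set b := exp _; ring.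
Qed.

Lemma goe_weightE n v : goe_weight n v =
  exp (- (2^-1 * \sum_(i < n) \sum_(j < n) symM v i j ^+ 2))%R
  / (sqrt (IZR 2) ^+ n * sqrt PI ^+ symdim n).
Proof.
elim: n => [|n IHn]; first by rewrite big_ord0 mulr0 oppr0 exp_0 !expr0 mulr1 divr1.
pose c i := symM v i n.
rewrite /= IHn col_weightE symdim_S RmultE.
have vc i : (i <= n)%N -> v (symdim n + i)%N = c i.
  by move=> /leP/Nat.leb_le ilt; rewrite /c /symM ilt.
have -> : \sum_(i < n) v (symdim n + i)%N ^+ 2 = \sum_(i < n) c i ^+ 2.
  by apply: eq_bigr => i _; rewrite vc // ltnW.
rewrite vc //.
(* In the trace of the square an entry above the diagonal counts twice and a diagonal entry once;
   halving gives the exponents of the variances 1/2 and 1. *)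
have -> : \sum_(i < n.+1) \sum_(j < n.+1) symM v i j ^+ 2 =
    \sum_(i < n) \sum_(j < n) symM v i j ^+ 2 + (\sum_(i < n) c i ^+ 2) *+ 2 + c n ^+ 2.
  transitivity (\sum_(i < n) (\sum_(j < n) symM v i j ^+ 2 + c i ^+ 2)
      + (\sum_(j < n) symM v n j ^+ 2 + c n ^+ 2)).
    rewrite big_ord_recr; congr (_ + _); last exact: big_ord_recr.
    by apply: eq_bigr => i _; exact: big_ord_recr.
  have -> : \sum_(j < n) symM v n j ^+ 2 = \sum_(j < n) c j ^+ 2.
    by apply: eq_bigr => j _; rewrite symM_sym.
  by rewrite big_split /= mulr2n -!addrA.
set S := \sum_(i < n) \sum_(j < n) _; set C := \sum_(i < n) _.
have -> : - (2^-1 * (S + C *+ 2 + c n ^+ 2)) = - (2^-1 * S) + - (C + 2^-1 * c n ^+ 2) :> R.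
  by field.
rewrite exp_addr exprD (exprS (sqrt (IZR 2))) !invfM.
set a := exp _; set b := exp _; ring.
Qed.

(** Positivity matters because of the truncated [n - 1] in [trsq]: at [n = 0] the sum would still
    contain the entry (0,0). *)
Lemma goe_densityE n v : (0 < n)%N -> goe_density n (symM v) = goe_weight n v.
Proof.
case: n => // n _; rewrite goe_weightE /goe_density RdivE RmultE !RpowE.
congr (exp _ / _); rewrite RdivE RoppE mulNr mulrC; congr (- (_ * _)).
rewrite /trsq Nat.sub_succ Nat.sub_0_r sum_f_R0E; apply: eq_bigr => i _.
by rewrite sum_f_R0E; apply: eq_bigr => j _; rewrite RmultE expr2 [symM v j i]symM_sym.
Qed.

Lemma sqcharpoly0 n (Q : 'M[R]_n) : (sqcharpoly Q)`_0 = char_poly Q ^+ 2.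
Proof.
have ev z p : z.[0] = 'X -> (polyev z p).[0] = p :> {poly R}.
  by move=> z0; rewrite /polyev horner_comp z0 -/(p \Po 'X) comp_polyXr.
rewrite /sqcharpoly coef_even_poly -horner_coef0 /charpoly2 hornerM.
by rewrite !ev // !(hornerD, hornerN, hornerC, hornerX) ?oppr0 addr0.
Qed.

Lemma fact_factorial n : Factorial.fact n = n`!.
Proof. by elim: n => //= n ->. Qed.

Lemma IntR_goe_det_sq (k : nat) : (0 < k)%N ->
  exists E : R -> R,
    (forall u : R,
       IntRn (symdim k)
         (fun v => Rmult (pow (Defs.det k (shift (symM v) u)) 2) (goe_density k (symM v)))
         (E u)) /\
    IntR (fun u => Rmult (E u) (exp (Ropp (pow u 2))))
         (Rdiv (Rmult (sqrt PI) (INR (Factorial.fact (k + 2)))) (pow (IZR 2) (k + 1))).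
Proof.
move=> k0.
(* Evaluation at [w = 0] and [x = u], which turns [sqcharpoly] into the squared determinant. *)
pose L u (F : {poly {poly R}}) : R := (F`_0).[u].
have kL u : klinear (L u).
  split=> [F G|c F]; first by rewrite /L coefD hornerD.
  by rewrite /L coefCM hornerM hornerC.
pose F := (16^-1 ^+ k)%:P%:P * iter k (@goe_step R) 1.
exists (fun u => L u F); split=> [u|].
  apply: (IntRn_ext _ _ _ _ _ (polyExp_goe k (kL u))) => v.
  rewrite /L sqcharpoly0 horner_exp -det_shift goe_densityE ?RpowE //.
have pi0 := sqrt_neq0 PI_RGT_0.
have half0 : Rlt 0 (2^-1)%R by exact: (Rinv_0_lt_compat 2 Rlt_0_2).
(* [exp (- u^2)] is [sqrt PI] times the density of variance 1/2, and the scaling [16^-k] against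
   [8^k (k + 2)! / 2] leaves [(k + 2)! / 2^(k + 1)]. *)
have -> : Rdiv (Rmult (sqrt PI) (INR (Factorial.fact (k + 2)))) (pow (IZR 2) (k + 1)) =
    Rmult (sqrt PI) (moment_fun (gauss_moment (2^-1)%R) F`_0).
  rewrite /F coefCM moment_funZ moment_fun_iter_goe_step //; last first.
    by move=> m; rewrite -(INR_natr m.+1).
  rewrite RdivE RmultE RmultE RpowE INR_natr fact_factorial -mulrA; congr (_ * _).
  rewrite -(exprVn (IZR 2)); have -> : (IZR 2)^-1 = 2^-1 :> R by [].
  have -> : 16^-1 = 2^-1 * 8^-1 :> R by field.
  have e8 : (8^-1) ^+ k * 8 ^+ k = 1 :> R by rewrite -exprMn mulVf ?expr1n ?pnatr_eq0.
  rewrite exprMn exprD expr1; move: e8; move: (_ ^+ k) (_ ^+ k) (_ ^+ k) => B C A e8.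
  have eB : B = B * (A * C) by rewrite e8 mulr1.
  by rewrite {1}eB; ring.
apply: (IntR_ext _ _ _ _ (IntR_scal (sqrt PI) _ _ (IntR_poly_gauss F`_0 half0))) => u.
rewrite (gauss_half u) /L RdivE !RmultE mulrCA; congr (_ * _).
by rewrite mulrCA mulfV // mulr1.
Qed.

End GOEExpectation.

Open Scope R_scope.

(* E(u) := E_{Q~GOE(k)}[det(Q - u 1)^2] exists (as an integral over Sym(k,R)
   in the coordinates A_ij, i<=j) and int_R E(u) e^{-u^2} du = sqrt(pi)(k+2)!/2^(k+1). *)
Theorem theorem1p6 (k : nat) (hk : (1 <= k)%nat) :
  exists E : R -> R,
    (forall u : R,
       IntRn (symdim k)
         (fun v => det k (shift (symM v) u) ^ 2 * goe_density k (symM v))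
         (E u)) /\
    IntR (fun u => E u * exp (- u ^ 2))
         (sqrt PI * INR (Factorial.fact (k + 2)) / 2 ^ (k + 1)).
Proof.
apply GOEExpectation.IntR_goe_det_sq.
now apply (ssrbool.introT ssrnat.ltP).
Qed.
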